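(* Let $G$ be a locally compact, unimodular, metrizable group, let $d$ be a left-invariant proper metric on $G$ inducing its topology, and let $\Gamma<G$ be a discrete cocompact subgroup. Let $F$ be a finitely generated free group with a symmetric free generating set $S$, and let $\phi:F\to G$ be a homomorphism. Then for every $\epsilon>0$ there exists an $\epsilon$-perturbation $\phi_\epsilon:F\to G$ of $\phi$ that is virtually a homomorphism into $\Gamma$.
   Context: A symmetric free generating set of a free group $F$ is a set $S=B\cup B^{-1}$ where $B$ is a free basis of $F$. Given a group $F$ with finite symmetric generating set $S$, a homomorphism $\phi:F\to G$ and $\epsilon>0$, a map $\phi_\epsilon:F\to G$ (not necessarily a homomorphism, and not required to send the identity to the identity) is an $\epsilon$-perturbation of $\phi$ if $d(\phi_\epsilon(fs),\phi_\epsilon(f)\phi(s))\le\epsilon$ for all $f\in F$, $s\in S$. A map $\phi_\epsilon:F\to G$ is virtually a homomorphism into $\Gamma$ if there is a finite-index subgroup $F'<F$ such that $\phi_\epsilon(f_1f_2)=\phi_\epsilon(f_1)\phi_\epsilon(f_2)$ for all $f_1\in F'$, $f_2\in F$, and moreover $\phi_\epsilon(F')\subset\Gamma$. *)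

(* Defs.v *)
From Stdlib Require Import Reals List.
Open Scope R_scope.

Record group := Group {
  gcar :> Type;
  gmul : gcar -> gcar -> gcar;
  ginv : gcar -> gcar;
  gone : gcar;
  gmulA : forall x y z, gmul x (gmul y z) = gmul (gmul x y) z;
  gmul1l : forall x, gmul gone x = x;
  gmul1r : forall x, gmul x gone = x;
  gmulVl : forall x, gmul (ginv x) x = gone;
  gmulVr : forall x, gmul x (ginv x) = gone
}.
Arguments gmul {g} _ _.
Arguments ginv {g} _.
Arguments gone {g}.

Definition is_hom {G H : group} (f : G -> H) : Prop :=
  forall x y : G, f (gmul x y) = gmul (f x) (f y).

Definition is_subgroup {G : group} (P : G -> Prop) : Prop :=
  P gone /\ (forall x y, P x -> P y -> P (gmul x y)) /\ (forall x, P x -> P (ginv x)).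

Definition finite_index {G : group} (P : G -> Prop) : Prop :=
  exists reps : list G, forall g : G, exists r h, In r reps /\ P h /\ g = gmul r h.

Definition free_basis (F : group) (n : nat) (b : nat -> F) : Prop :=
  forall (H : group) (h : nat -> H),
    exists f : F -> H, is_hom f /\ (forall i, (i < n)%nat -> f (b i) = h i) /\
      (forall g : F -> H, is_hom g -> (forall i, (i < n)%nat -> g (b i) = h i) ->
         forall x, g x = f x).

Definition in_sym_gen {F : group} (n : nat) (b : nat -> F) (s : F) : Prop :=
  exists i, (i < n)%nat /\ (s = b i \/ s = ginv (b i)).

Definition is_metric {X : Type} (d : X -> X -> R) : Prop :=
  (forall x y, 0 <= d x y) /\ (forall x y, d x y = 0 <-> x = y) /\
  (forall x y, d x y = d y x) /\ (forall x y z, d x z <= d x y + d y z).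

Definition converges {X : Type} (d : X -> X -> R) (u : nat -> X) (x : X) : Prop :=
  forall eps, 0 < eps -> exists N, forall k, (N <= k)%nat -> d (u k) x < eps.

(** Compactness in a metric space = sequential compactness. *)
Definition compact {X : Type} (d : X -> X -> R) (K : X -> Prop) : Prop :=
  forall u : nat -> X, (forall k, K (u k)) ->
    exists (sigma : nat -> nat) (x : X),
      (forall k, (sigma k < sigma (S k))%nat) /\ K x /\ converges d (fun k => u (sigma k)) x.

Definition proper_metric {X : Type} (d : X -> X -> R) : Prop :=
  forall x r, compact d (fun y => d x y <= r).

Definition left_invariant {G : group} (d : G -> G -> R) : Prop :=
  forall g x y : G, d (gmul g x) (gmul g y) = d x y.

Definition topological_group {G : group} (d : G -> G -> R) : Prop :=
  (forall x y eps, 0 < eps -> exists delta, 0 < delta /\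
     forall x' y', d x x' < delta -> d y y' < delta -> d (gmul x y) (gmul x' y') < eps) /\
  (forall x eps, 0 < eps -> exists delta, 0 < delta /\
     forall x', d x x' < delta -> d (ginv x) (ginv x') < eps).

Definition locally_compact {X : Type} (d : X -> X -> R) : Prop :=
  forall x, exists r, 0 < r /\ compact d (fun y => d x y <= r).

Definition discrete_in {X : Type} (d : X -> X -> R) (P : X -> Prop) : Prop :=
  forall x, P x -> exists r, 0 < r /\ forall y, P y -> d x y < r -> y = x.

(** Cocompact: G = K Γ for some compact K (i.e. G/Γ compact). *)
Definition cocompact {G : group} (d : G -> G -> R) (P : G -> Prop) : Prop :=
  exists K : G -> Prop, compact d K /\
    forall g : G, exists k y, K k /\ P y /\ g = gmul k y.

Definition perturbation {F G : group} (d : G -> G -> R) (n : nat) (b : nat -> F)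
  (phi phie : F -> G) (eps : R) : Prop :=
  forall (f s : F), in_sym_gen n b s -> d (phie (gmul f s)) (gmul (phie f) (phi s)) <= eps.

Definition virtually_hom_into {F G : group} (phie : F -> G) (Gam : G -> Prop) : Prop :=
  exists F' : F -> Prop, is_subgroup F' /\ finite_index F' /\
    (forall f1 f2, F' f1 -> phie (gmul f1 f2) = gmul (phie f1) (phie f2)) /\
    (forall f1, F' f1 -> Gam (phie f1)).

(* Main.v *)
Require Import Defs.
From Stdlib Require Import Reals List.
From Stdlib Require Import Permutation FinFun Arith Lia Lra ZArith.
From Stdlib Require Import Classical ClassicalEpsilon FunctionalExtensionality ProofIrrelevance.
Open Scope R_scope.

(** It suffices to find finitely many points of the compact space [Gam \ G], among them
    the base point, and for each free generator [s] a permutation of these points that moves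
    every point close to its right translate by [phi s]: lifting the points to [G], each
    edge of the resulting action of [F] gets a label in [Gam], and [phie f] is the product
    of the labels along the path [f] from the base point, times the lift of its endpoint.
    [F'] is the stabilizer of the base point.

    Cut [Gam \ G] into small cells. Permutations of a multiset of cells amount to integral
    cell weights together with, for each generator, an integral flow with these weights as
    both marginals, supported on the pairs of cells allowed by the translation. By Farkas'
    lemma this system of rational equations has an integral solution unless a dual
    certificate exists. A certificate is refuted by integrating it against Haar measure, for
    which a net [S] of minimal cardinality at a much finer scale is a substitute: by
    minimality and left invariance of [d], left translates of a small set contain almost the
    same number of points of [Gam S]. Counting in this way both balls and their conjugates by
    [phi s] shows that the kernel "[y] is close to [x phi(s)]" on [S] has almost constant row
    and column sums; equality of their averages takes the place of unimodularity. *)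

(** * Finite sums and Farkas' lemma *)

Definition sumR {A : Type} (l : list A) (f : A -> R) : R :=
  fold_right (fun a s => f a + s) 0 l.

Definition indic (P : Prop) : R := if excluded_middle_informative P then 1 else 0.

Lemma indic_true (P : Prop) : P -> indic P = 1.
Proof. intros h; unfold indic; destruct (excluded_middle_informative P); tauto. Qed.

Lemma indic_false (P : Prop) : ~ P -> indic P = 0.
Proof. intros h; unfold indic; destruct (excluded_middle_informative P); tauto. Qed.

Lemma indic_ge0 (P : Prop) : 0 <= indic P.
Proof. unfold indic; destruct (excluded_middle_informative P); lra. Qed.

Lemma indic_le (P Q : Prop) : (P -> Q) -> indic P <= indic Q.
Proof.
  intros h; unfold indic.
  destruct (excluded_middle_informative P), (excluded_middle_informative Q); tauto || lra.
Qed.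

Lemma indic_ext (P Q : Prop) : (P <-> Q) -> indic P = indic Q.
Proof. intros [h1 h2]; apply Rle_antisym; apply indic_le; assumption. Qed.

Section Sums.
Context {A : Type}.
Implicit Types (l : list A) (f g : A -> R).

Lemma sumR_le l f g : (forall a, In a l -> f a <= g a) -> sumR l f <= sumR l g.
Proof.
  induction l as [|a l IH]; simpl; intros h; [lra|].
  pose proof (h a (or_introl eq_refl)).
  pose proof (IH (fun b hb => h b (or_intror hb))). unfold sumR in *; lra.
Qed.

Lemma sumR_ext l f g : (forall a, In a l -> f a = g a) -> sumR l f = sumR l g.
Proof. intros h; apply Rle_antisym; apply sumR_le; intros a ha; rewrite (h a ha); lra. Qed.

Lemma sumR_const l (c : R) : sumR l (fun _ => c) = INR (length l) * c.
Proof.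
  induction l as [|a l IH]; [simpl; lra|].
  change (length (a :: l)) with (S (length l)); rewrite S_INR; simpl; rewrite IH; lra.
Qed.

Lemma sumR_0 l : sumR l (fun _ => 0) = 0.
Proof. rewrite sumR_const; lra. Qed.

Lemma sumR_ge0 l f : (forall a, In a l -> 0 <= f a) -> 0 <= sumR l f.
Proof. intros h; rewrite <- (sumR_0 l); apply sumR_le, h. Qed.

Lemma sumR_plus l f g : sumR l (fun a => f a + g a) = sumR l f + sumR l g.
Proof. induction l as [|a l IH]; simpl; lra. Qed.

Lemma sumR_scal l f (c : R) : sumR l (fun a => c * f a) = c * sumR l f.
Proof. induction l as [|a l IH]; simpl; lra. Qed.

Lemma sumR_app l l' f : sumR (l ++ l') f = sumR l f + sumR l' f.
Proof. induction l as [|a l IH]; simpl; lra. Qed.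

Lemma sumR_repeat (a : A) (n : nat) f : sumR (repeat a n) f = INR n * f a.
Proof. induction n as [|n IH]; [simpl; lra|]. rewrite S_INR; simpl; rewrite IH; lra. Qed.

Lemma sumR_term_le l f (a : A) : (forall b, In b l -> 0 <= f b) -> In a l -> f a <= sumR l f.
Proof.
  induction l as [|b l IH]; simpl; intros h ha; [contradiction|].
  assert (0 <= f b) by auto.
  assert (0 <= sumR l f) by (apply sumR_ge0; auto).
  destruct ha as [->|ha]; [unfold sumR in *; lra|].
  specialize (IH (fun b hb => h b (or_intror hb)) ha). unfold sumR in *; lra.
Qed.

Lemma sumR_delta l f (a : A) : NoDup l -> In a l ->
  sumR l (fun b => indic (b = a) * f b) = f a.
Proof.
  induction l as [|b l IH]; simpl; intros hl ha; [contradiction|].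
  inversion hl as [|? ? hb hl']; subst.
  destruct ha as [->|ha].
  - rewrite indic_true by reflexivity.
    fold (sumR l (fun b => indic (b = a) * f b)).
    rewrite (sumR_ext _ _ (fun _ => 0)), sumR_0; [lra|].
    intros c hc; rewrite indic_false; [lra|congruence].
  - fold (sumR l (fun b => indic (b = a) * f b)).
    rewrite IH, indic_false by (assumption || congruence); lra.
Qed.

Lemma length_filter_indic l (P : A -> Prop) :
  INR (length (filter (fun a => if excluded_middle_informative (P a) then true else false) l))
  = sumR l (fun a => indic (P a)).
Proof.
  induction l as [|a l IH]; [reflexivity|].
  simpl filter; simpl sumR; unfold indic at 1.
  destruct (excluded_middle_informative (P a)).
  - simpl length; rewrite S_INR, IH; unfold sumR; lra.
  - rewrite IH; unfold sumR; lra.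
Qed.
End Sums.

Lemma sumR_swap {A B : Type} (l : list A) (l' : list B) (f : A -> B -> R) :
  sumR l (fun a => sumR l' (f a)) = sumR l' (fun b => sumR l (fun a => f a b)).
Proof.
  induction l as [|a l IH]; simpl; [symmetry; apply sumR_0|].
  rewrite IH, <- sumR_plus; reflexivity.
Qed.

Lemma sumR_map {A B : Type} (l : list A) (h : A -> B) (f : B -> R) :
  sumR (map h l) f = sumR l (fun a => f (h a)).
Proof. induction l as [|a l IH]; simpl; [reflexivity|rewrite IH; reflexivity]. Qed.

Lemma sumR_concat {A : Type} (ll : list (list A)) (f : A -> R) : sumR (concat ll) f = sumR ll (fun l => sumR l f).
Proof. induction ll as [|l ll IH]; simpl; [reflexivity|rewrite sumR_app, IH; reflexivity]. Qed.

Lemma sumR_list_prod {A B : Type} (l : list A) (l' : list B) (f : A * B -> R) :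
  sumR (list_prod l l') f = sumR l (fun a => sumR l' (fun b => f (a, b))).
Proof.
  induction l as [|a l IH]; simpl; [reflexivity|].
  rewrite sumR_app, sumR_map, IH; reflexivity.
Qed.

(** Used to choose the multiplier of an eliminated row, which is subject to finitely many lower and
    upper bounds. *)
Lemma separate_lists (A B : list R) : (forall a b, In a A -> In b B -> a <= b) ->
  exists y, (forall a, In a A -> a <= y) /\ (forall b, In b B -> y <= b).
Proof.
  revert B; induction A as [|a A IH]; intros B h.
  - clear h; induction B as [|b B [y [_ hy]]].
    + exists 0; split; intros ? [].
    + exists (Rmin b y); split; [intros ? []|].
      intros c [<-|hc]; [apply Rmin_l|].
      eapply Rle_trans; [apply Rmin_r|auto].
  - destruct (IH B) as [y [h1 h2]]; [intros; apply h; simpl; auto|].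
    exists (Rmax a y); split.
    + intros c [<-|hc]; [apply Rmax_l|].
      eapply Rle_trans; [|apply Rmax_r]; auto.
    + intros b hb; apply Rmax_lub; auto; apply h; simpl; auto.
Qed.

(* Farkas' alternative with an integral primal solution, presented as a list of
   columns with repetitions. Rows are eliminated one at a time, as in Motzkin's
   double description method. *)
Lemma integral_farkas {Row : Type} (rows : list Row) : NoDup rows -> forall (C : Type) (cols : list C)
  (u : C -> Z) (a : C -> Row -> Z),
  (exists l, incl l cols /\ (forall r, In r rows -> sumR l (fun c => IZR (a c r)) = 0) /\
     0 < sumR l (fun c => IZR (u c))) \/
  (exists y : Row -> R, forall c, In c cols ->
     IZR (u c) <= sumR rows (fun r => y r * IZR (a c r))).
Proof.
  induction rows as [|r0 rows IH]; intros hnd C cols u a.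
  - destruct (classic (exists c, In c cols /\ (0 < u c)%Z)) as [[c [hc hu]]|hno].
    + left; exists (c :: nil); split; [intros x [<-|[]]; exact hc|split; [intros r []|]].
      simpl; apply IZR_lt in hu; lra.
    + right; exists (fun _ => 0); intros c hc; simpl.
      apply IZR_le, Z.nlt_ge; intros hu; apply hno; eauto.
  - inversion hnd as [|? ? hr0 hnd']; subst.
    set (t := fun c => a c r0).
    set (zero := map (fun c => c :: nil) (filter (fun c => Z.eqb (t c) 0) cols)).
    (* Taking [n] with multiplicity [t p] and [p] with multiplicity [- t n] cancels row [r0]. Both
       multiplicities are natural numbers, which keeps the solution integral. *)
    set (pair := fun pn : C * C =>
      repeat (snd pn) (Z.to_nat (t (fst pn))) ++ repeat (fst pn) (Z.to_nat (- t (snd pn)))).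
    set (pairs := map pair (list_prod (filter (fun c => Z.ltb 0 (t c)) cols)
                                      (filter (fun c => Z.ltb (t c) 0) cols))).
    assert (hpair : forall p n f, (0 < t p)%Z -> (t n < 0)%Z ->
      sumR (pair (p, n)) f = IZR (t p) * f n - IZR (t n) * f p).
    { intros p n f hp hn; unfold pair; simpl.
      rewrite sumR_app, !sumR_repeat, !INR_IZR_INZ, !Z2Nat.id by lia.
      rewrite opp_IZR; lra. }
    set (asum := fun (l : list C) r => fold_right (fun c s => (a c r + s)%Z) 0%Z l).
    set (usum := fun (l : list C) => fold_right (fun c s => (u c + s)%Z) 0%Z l).
    assert (hasum : forall l r, IZR (asum l r) = sumR l (fun c => IZR (a c r))).
    { intros l r; induction l; simpl; [reflexivity|]. rewrite plus_IZR, IHl; reflexivity. }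
    assert (husum : forall l, IZR (usum l) = sumR l (fun c => IZR (u c))).
    { intros l; induction l; simpl; [reflexivity|]. rewrite plus_IZR, IHl; reflexivity. }
    destruct (IH hnd' (list C) (zero ++ pairs) usum asum) as [[l [hl [hrows hu]]]|[y hy]].
    + left; exists (concat l).
      assert (hcol : forall m, In m (zero ++ pairs) ->
        incl m cols /\ sumR m (fun c => IZR (a c r0)) = 0).
      { intros m hm; apply in_app_or in hm as [hm|hm]; apply in_map_iff in hm as [c [<- hc]].
        - apply filter_In in hc as [hc ht]; apply Z.eqb_eq in ht.
          split; [intros x [<-|[]]; exact hc|]. simpl; fold (t c); rewrite ht; lra.
        - destruct c as [p n]; apply in_prod_iff in hc as [hp hn].
          apply filter_In in hp as [hp hp']; apply filter_In in hn as [hn hn'].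
          apply Z.ltb_lt in hp', hn'; split.
          + intros x hx; unfold pair in hx; simpl in hx.
            apply in_app_or in hx as [hx|hx]; apply repeat_spec in hx; subst; assumption.
          + rewrite hpair by assumption; unfold t; lra. }
      split; [|split].
      * intros c hc; apply in_concat in hc as [m [hm hc]].
        exact (proj1 (hcol m (hl m hm)) c hc).
      * intros r hr; rewrite sumR_concat; destruct hr as [<-|hr].
        -- rewrite (sumR_ext _ _ (fun _ => 0)), sumR_0; [reflexivity|].
           intros m hm; apply hcol, hl, hm.
        -- rewrite <- (hrows r hr); apply sumR_ext; intros; symmetry; apply hasum.
      * rewrite sumR_concat; eapply Rlt_le_trans; [exact hu|].
        apply sumR_le; intros; rewrite husum; lra.
    + right.
      (* [s c] is the excess left by the multipliers [y]. A multiplier [Y] for [r0] must satisfy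
         [s c <= Y * t c]: a lower bound when [t c > 0], an upper bound when [t c < 0]. The
         inequality for [pair (p, n)] says that the bounds from [p] and [n] are compatible. *)
      set (s := fun c => IZR (u c) - sumR rows (fun r => y r * IZR (a c r))).
      assert (hs : forall m, In m (zero ++ pairs) -> sumR m s <= 0).
      { intros m hm; specialize (hy m hm); rewrite husum in hy.
        rewrite (sumR_ext rows _ (fun r => sumR m (fun c => y r * IZR (a c r)))) in hy
          by (intros; rewrite hasum, sumR_scal; reflexivity).
        rewrite sumR_swap in hy; unfold s.
        rewrite (sumR_ext m _ (fun c => IZR (u c)
          + (-1) * sumR rows (fun r => y r * IZR (a c r)))) by (intros; lra).
        rewrite sumR_plus, sumR_scal; lra. }
      destruct (separate_lists
        (map (fun c => s c / IZR (t c)) (filter (fun c => Z.ltb 0 (t c)) cols))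
        (map (fun c => s c / IZR (t c)) (filter (fun c => Z.ltb (t c) 0) cols)))
        as [Y [hY1 hY2]].
      { intros x x' hx hx'; apply in_map_iff in hx as [p [<- hp]].
        apply in_map_iff in hx' as [n [<- hn]].
        assert (h : sumR (pair (p, n)) s <= 0).
        { apply hs, in_or_app; right; apply in_map, in_prod_iff; auto. }
        apply filter_In in hp as [hp hp']; apply filter_In in hn as [hn hn'].
        apply Z.ltb_lt in hp', hn'; rewrite hpair in h by assumption.
        apply IZR_lt in hp', hn'.
        apply Rmult_le_reg_l with (IZR (t p)); [lra|].
        apply Rmult_le_reg_l with (- IZR (t n)); [lra|].
        replace (- IZR (t n) * (IZR (t p) * (s p / IZR (t p)))) with (- IZR (t n) * s p)
          by (field; lra).
        replace (- IZR (t n) * (IZR (t p) * (s n / IZR (t n)))) with (- (IZR (t p) * s n))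
          by (field; lra).
        lra. }
      set (y0 := fun c => sumR rows (fun r => y r * IZR (a c r))).
      assert (hY : forall c, In c cols -> IZR (u c) <= Y * IZR (t c) + y0 c).
      { intros c hc; assert (hsc : s c = IZR (u c) - y0 c) by reflexivity.
        destruct (Z.lt_trichotomy (t c) 0) as [ht|[ht|ht]].
        - assert (h : Y <= s c / IZR (t c)).
          { apply hY2, in_map_iff; exists c; split; [reflexivity|].
            apply filter_In; split; [exact hc|]. apply Z.ltb_lt, ht. }
          apply IZR_lt in ht. apply Rmult_le_compat_r with (r := - IZR (t c)) in h; [|lra].
          replace (s c / IZR (t c) * - IZR (t c)) with (- s c) in h by (field; lra). lra.
        - assert (h : sumR (c :: nil) s <= 0).
          { apply hs, in_or_app; left; apply in_map_iff; exists c; split; [reflexivity|].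
            apply filter_In; split; [exact hc|]. apply Z.eqb_eq, ht. }
          simpl in h; rewrite ht; lra.
        - assert (h : s c / IZR (t c) <= Y).
          { apply hY1, in_map_iff; exists c; split; [reflexivity|].
            apply filter_In; split; [exact hc|]. apply Z.ltb_lt, ht. }
          apply IZR_lt in ht. apply Rmult_le_compat_r with (r := IZR (t c)) in h; [|lra].
          replace (s c / IZR (t c) * IZR (t c)) with (s c) in h by (field; lra). lra. }
      exists (fun r => if excluded_middle_informative (r = r0) then Y else y r).
      intros c hc; eapply Rle_trans; [exact (hY c hc)|]; apply Req_le; simpl.
      destruct (excluded_middle_informative (r0 = r0)); [|congruence].
      f_equal; apply sumR_ext; intros r hr.
      destruct (excluded_middle_informative (r = r0)); [congruence|reflexivity].
Qed.

(** * Permutations from integral flows *)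

(** Extending the permutation of positions by the identity makes [sg] and [tau] mutually inverse on
    all of [nat], as [labelled_perm] will require. *)
Lemma permutation_of_lists (W W' : list nat) : Permutation W W' ->
  exists sg tau : nat -> nat,
    (forall v, tau (sg v) = v) /\ (forall v, sg (tau v) = v) /\
    (forall v, (v < length W)%nat <-> (sg v < length W)%nat) /\
    (forall v, (v < length W)%nat -> nth (sg v) W 0%nat = nth v W' 0%nat).
Proof.
  intros h; apply (Permutation_nth W W' 0%nat) in h as [hlen [f [hf [hinj hnth]]]].
  destruct (bSurjective_bBijective hf (proj1 (bInjective_bSurjective hf) hinj))
    as [g [hg hfg]].
  set (m := length W) in *.
  exists (fun v => if lt_dec v m then f v else v), (fun v => if lt_dec v m then g v else v).
  split; [|split; [|split]]; intros v.
  - destruct (lt_dec v m) as [hv|hv].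
    + destruct (lt_dec (f v) m) as [_|hn]; [apply hfg, hv|destruct (hn (hf v hv))].
    + destruct (lt_dec v m); tauto.
  - destruct (lt_dec v m) as [hv|hv].
    + destruct (lt_dec (g v) m) as [_|hn]; [apply hfg, hv|destruct (hn (hg v hv))].
    + destruct (lt_dec v m); tauto.
  - destruct (lt_dec v m) as [hv|hv]; [split; auto|tauto].
  - intros hv; destruct (lt_dec v m); [symmetry; apply hnth, hv|tauto].
Qed.

(** The unknowns of the flow problem: [Vtx j] is a unit of weight on cell [j], and [Edge i j k] is a
    unit of flow from [j] to [k] for generator [i]. A list of them encodes a nonnegative integral
    assignment. *)
Inductive flow_var := Vtx (j : nat) | Edge (i j k : nat).

Definition verts (c : flow_var) : list nat := match c with Vtx j => j :: nil | _ => nil end.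

Definition edges (i : nat) (c : flow_var) : list (nat * nat) :=
  match c with
  | Edge i' j k => if Nat.eq_dec i' i then (j, k) :: nil else nil
  | Vtx _ => nil
  end.

Definition endpoint (s : bool) : nat * nat -> nat := if s then fst else snd.

(** Row [(s, (i, j))] equates the weight of cell [j] with the flow of generator [i] leaving [j] if
    [s] is [true], entering [j] if [s] is [false]. *)
Definition flow_coef (c : flow_var) (r : bool * (nat * nat)) : Z :=
  (Z.of_nat (count_occ Nat.eq_dec
      (map (endpoint (fst r)) (edges (fst (snd r)) c)) (snd (snd r)))
   - Z.of_nat (count_occ Nat.eq_dec (verts c) (snd (snd r))))%Z.

Lemma sum_flow_coef (l : list flow_var) s i j :
  sumR l (fun c => IZR (flow_coef c (s, (i, j)))) =
  INR (count_occ Nat.eq_dec (map (endpoint s) (flat_map (edges i) l)) j)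
  - INR (count_occ Nat.eq_dec (flat_map verts l) j).
Proof.
  induction l as [|c l IH]; [simpl; lra|].
  simpl flat_map; rewrite map_app, !count_occ_app, !plus_INR.
  change (sumR (c :: l) (fun c => IZR (flow_coef c (s, (i, j))))) with
    (IZR (flow_coef c (s, (i, j))) + sumR l (fun c => IZR (flow_coef c (s, (i, j))))).
  rewrite IH; unfold flow_coef; simpl fst; simpl snd.
  rewrite minus_IZR, <- !INR_IZR_INZ; lra.
Qed.

Lemma count_singleton (j k : nat) : INR (count_occ Nat.eq_dec (j :: nil) k) = indic (k = j).
Proof.
  simpl; destruct (Nat.eq_dec j k).
  - rewrite indic_true by congruence; reflexivity.
  - rewrite indic_false by congruence; reflexivity.
Qed.

Lemma NoDup_list_prod {A B : Type} (l : list A) (l' : list B) :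
  NoDup l -> NoDup l' -> NoDup (list_prod l l').
Proof.
  intros hl hl'; induction hl as [|a l ha hl IH]; simpl; [constructor|].
  apply NoDup_app; [apply Injective_map_NoDup; [intros x y e; congruence|exact hl']|exact IH|].
  intros [x y] h1 h2; apply in_map_iff in h1 as [b [e _]]; injection e as <- <-.
  apply in_prod_iff in h2 as [h2 _]; contradiction.
Qed.

(* Vertices of the finite action carry a cell; the alternative [alpha], [beta] is the
   Farkas dual of the existence of integral cell weights that admit, for every
   generator [i], a flow along [adj i] with these weights as both marginals. *)
Lemma permutations_or_dual (n M : nat) (adj : nat -> nat -> nat -> Prop) :
  (exists (m : nat) (cell : nat -> nat) (v0 : nat),
     (v0 < m)%nat /\ cell v0 = 0%nat /\
     forall i, (i < n)%nat -> exists sg tau : nat -> nat,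
       (forall v, tau (sg v) = v) /\ (forall v, sg (tau v) = v) /\
       (forall v, (v < m)%nat <-> (sg v < m)%nat) /\
       (forall v, (v < m)%nat -> adj i (cell v) (cell (sg v)))) \/
  (exists alpha beta : nat -> nat -> R,
     (forall i j k, (i < n)%nat -> (j < M)%nat -> (k < M)%nat -> adj i j k ->
        0 <= alpha i j + beta i k) /\
     (forall j, (j < M)%nat ->
        indic (j = 0%nat) + sumR (seq 0 n) (fun i => alpha i j + beta i j) <= 0)).
Proof.
  set (rows := list_prod (true :: false :: nil) (list_prod (seq 0 n) (seq 0 M))).
  set (cols := map Vtx (seq 0 M) ++
    map (fun e => Edge (fst e) (fst (snd e)) (snd (snd e)))
      (filter (fun e => if excluded_middle_informative (adj (fst e) (fst (snd e)) (snd (snd e)))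
                        then true else false)
        (list_prod (seq 0 n) (list_prod (seq 0 M) (seq 0 M))))).
  assert (hV : forall j, In (Vtx j) cols <-> (j < M)%nat).
  { intros j; unfold cols; rewrite in_app_iff, !in_map_iff; split.
    - intros [[k [e hk]]|[e [he _]]]; [|discriminate].
      apply in_seq in hk; injection e as ->; lia.
    - intros hj; left; exists j; rewrite in_seq; split; [reflexivity|lia]. }
  assert (hE : forall i j k, In (Edge i j k) cols <->
    (i < n)%nat /\ (j < M)%nat /\ (k < M)%nat /\ adj i j k).
  { intros i j k; unfold cols; rewrite in_app_iff, !in_map_iff; split.
    - intros [[k' [e hk]]|[[i' [j' k']] [e he]]]; [discriminate|].
      apply filter_In in he as [he hadj]; simpl in *; injection e as -> -> ->.
      rewrite !in_prod_iff, !in_seq in he.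
      destruct (excluded_middle_informative (adj i j k)); [|discriminate]. intuition lia.
    - intros (hi & hj & hk & ha); right; exists (i, (j, k)); split; [reflexivity|].
      apply filter_In; rewrite !in_prod_iff, !in_seq; simpl; split; [lia|].
      destruct (excluded_middle_informative (adj i j k)); tauto. }
  assert (hR : NoDup rows).
  { repeat apply NoDup_list_prod; try apply seq_NoDup.
    repeat constructor; simpl; intuition congruence. }
  assert (hin : forall s i j, (i < n)%nat -> (j < M)%nat -> In (s, (i, j)) rows).
  { intros s i j hi hj; unfold rows; rewrite !in_prod_iff, !in_seq.
    split; [destruct s; simpl; tauto|lia]. }
  (* The objective is the weight of cell 0, so that a solution with positive objective has a vertex
     in the cell of the base point. *)
  set (u := fun c => match c with Vtx 0 => 1%Z | _ => 0%Z end).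
  destruct (integral_farkas rows hR flow_var cols u flow_coef)
    as [[l [hl [hrows hu]]]|[y hy]].
  - left; set (W := flat_map verts l).
    assert (hW : forall j, In j W <-> In (Vtx j) l).
    { intros j; unfold W; rewrite in_flat_map; split.
      - intros [[j'|? ? ?] [hc hj]]; simpl in hj; [|contradiction].
        destruct hj as [<-|[]]; exact hc.
      - intros h; exists (Vtx j); simpl; auto. }
    assert (h0 : In 0%nat W).
    { apply hW; apply NNPP; intros hno.
      rewrite (sumR_ext _ _ (fun _ => 0)), sumR_0 in hu; [lra|].
      intros [[|j]|? ? ?] hc; simpl; [contradiction|reflexivity|reflexivity]. }
    destruct (In_nth W 0%nat 0%nat h0) as [v0 [hv0 e0]].
    exists (length W), (fun v => nth v W 0%nat), v0; split; [exact hv0|split; [exact e0|]].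
    intros i hi.
    set (E := flat_map (edges i) l).
    assert (hEl : forall j k, In (j, k) E -> In (Edge i j k) l).
    { intros j k h; apply in_flat_map in h as [[?|i' j' k'] [hc h]]; simpl in h; [contradiction|].
      destruct (Nat.eq_dec i' i) as [->|]; [|contradiction].
      destruct h as [h|[]]; injection h as -> ->; exact hc. }
    assert (hperm : forall s, Permutation W (map (endpoint s) E)).
    { intros s; apply (Permutation_count_occ Nat.eq_dec); intros j.
      destruct (lt_dec j M) as [hj|hj].
      - specialize (hrows _ (hin s i j hi hj)); rewrite sum_flow_coef in hrows.
        fold E W in hrows; apply INR_eq; lra.
      - rewrite (proj1 (count_occ_not_In _ _ _)), (proj1 (count_occ_not_In _ _ _));
          [reflexivity| |].
        + intros h; apply in_map_iff in h as [[p q] [e h]].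
          apply hEl, hl, hE in h as (_ & h1 & h2 & _); destruct s; simpl in e; lia.
        + intros h; apply hW, hl, hV in h; lia. }
    (* Reorder the edges so that their sources read exactly [W]. Edge number [v] then leaves vertex
       [v], and the targets list the same cells in another order. *)
    destruct (Permutation_map_inv _ _ (hperm true)) as [E' [eW hE']].
    assert (hp : Permutation W (map snd E')).
    { eapply Permutation_trans; [exact (hperm false)|]. simpl; apply Permutation_map, hE'. }
    destruct (permutation_of_lists _ _ hp) as [sg [tau [h1 [h2 [h3 h4]]]]].
    exists sg, tau; split; [exact h1|split; [exact h2|split; [exact h3|]]].
    intros v hv; rewrite h4 by exact hv.
    assert (hv' : (v < length E')%nat) by (rewrite eW, length_map in hv; exact hv).
    rewrite eW; simpl.
    change 0%nat with (fst (0%nat, 0%nat)) at 1; change 0%nat with (snd (0%nat, 0%nat)) at 3.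
    rewrite !map_nth.
    destruct (nth v E' (0, 0)%nat) as [p q] eqn:e; simpl.
    apply (hE i p q), hl, hEl, (Permutation_in _ (Permutation_sym hE')).
    rewrite <- e; apply nth_In, hv'.
  - right; exists (fun i j => y (true, (i, j))), (fun i j => y (false, (i, j))); split.
    + intros i j k hi hj hk hadj.
      specialize (hy _ (proj2 (hE i j k) (conj hi (conj hj (conj hk hadj))))); simpl in hy.
      rewrite (sumR_ext rows _ (fun r => indic (r = (true, (i, j))) * y r
        + indic (r = (false, (i, k))) * y r)) in hy.
      * rewrite sumR_plus, !sumR_delta in hy by auto; lra.
      * intros [s [i' j']] _; unfold flow_coef; simpl.
        rewrite Z.sub_0_r, <- INR_IZR_INZ.
        destruct (Nat.eq_dec i i') as [<-|hne].
        -- simpl map; rewrite count_singleton; destruct s; simpl.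
           ++ rewrite (indic_false ((true, (i, j')) = (false, (i, k)))) by congruence.
              rewrite (indic_ext (j' = j) ((true, (i, j')) = (true, (i, j)))); [lra|].
              split; congruence.
           ++ rewrite (indic_false ((false, (i, j')) = (true, (i, j)))) by congruence.
              rewrite (indic_ext (j' = k) ((false, (i, j')) = (false, (i, k)))); [lra|].
              split; congruence.
        -- rewrite !indic_false by congruence; simpl; lra.
    + intros j hj; specialize (hy _ (proj2 (hV j) hj)).
      (* The column [Vtx j] has entry -1 in the rows of cell [j], for every generator and both
         marginals, and 0 elsewhere. *)
      rewrite (sumR_ext rows _ (fun r => indic (snd (snd r) = j) * (- y r))) in hy.
      2:{ intros [s [i k]] _; unfold flow_coef; simpl map; simpl count_occ at 1.
          simpl verts; rewrite minus_IZR, <- !INR_IZR_INZ, count_singleton; simpl; lra. }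
      unfold rows in hy; rewrite sumR_list_prod in hy; simpl sumR at 1 in hy.
      rewrite !sumR_list_prod in hy; simpl in hy.
      assert (hd : forall s, sumR (seq 0 n) (fun i => sumR (seq 0 M)
        (fun j' => indic (j' = j) * - y (s, (i, j')))) = - sumR (seq 0 n) (fun i => y (s, (i, j)))).
      { intros s.
        rewrite (sumR_ext _ _ (fun i => -1 * y (s, (i, j)))); [rewrite sumR_scal; lra|].
        intros i _; rewrite (sumR_delta (seq 0 M) (fun j' => - y (s, (i, j')))).
        - lra.
        - apply seq_NoDup.
        - apply in_seq; lia. }
      fold (sumR (seq 0 n)) in hy.
      rewrite !hd, sumR_plus in *.
      assert (hu0 : indic (j = 0%nat) = IZR (u (Vtx j))).
      { destruct j; [apply indic_true|apply indic_false]; congruence. }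
      simpl in hy, hu0; lra.
Qed.

(** * Minimal nets in the quotient *)

Section GroupLaws.
Context {G : group}.
Implicit Types x y : G.

Lemma gmulKV x y : gmul x (gmul (ginv x) y) = y.
Proof. rewrite gmulA, gmulVr, gmul1l; reflexivity. Qed.

Lemma gmulVK x y : gmul (ginv x) (gmul x y) = y.
Proof. rewrite gmulA, gmulVl, gmul1l; reflexivity. Qed.

Lemma ginv_unique x y : gmul x y = gone -> ginv x = y.
Proof. intros h; rewrite <- (gmulVK x y), h, gmul1r; reflexivity. Qed.

Lemma ginvK x : ginv (ginv x) = x.
Proof. apply ginv_unique, gmulVl. Qed.

Lemma ginv1 : ginv gone = gone :> G.
Proof. apply ginv_unique, gmul1l. Qed.

Lemma ginvM x y : ginv (gmul x y) = gmul (ginv y) (ginv x).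
Proof. apply ginv_unique; rewrite <- gmulA, gmulKV, gmulVr; reflexivity. Qed.
End GroupLaws.

Ltac grp :=
  repeat rewrite ginvM; repeat rewrite ginvK; rewrite ?ginv1;
  repeat rewrite <- gmulA;
  repeat (rewrite gmulKV || rewrite gmulVK || rewrite gmul1l || rewrite gmul1r
          || rewrite gmulVl || rewrite gmulVr);
  try reflexivity.

Section Hom.
Context {F H : group} (f : F -> H) (hf : is_hom f).

Lemma hom1 : f gone = gone.
Proof.
  rewrite <- (gmulVK (f gone) (f gone)) at 1; rewrite <- hf, gmul1l, gmulVl; reflexivity.
Qed.

Lemma homV x : f (ginv x) = ginv (f x).
Proof. symmetry; apply ginv_unique; rewrite <- hf, gmulVr; apply hom1. Qed.
End Hom.

(** Otherwise a greedy choice gives an infinite [rho]-separated sequence in [K], and two consecutive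
    terms of a convergent subsequence are too close. *)
Lemma totally_bounded {X : Type} (d : X -> X -> R) (hd : is_metric d) (K : X -> Prop) (rho : R) :
  Defs.compact d K -> 0 < rho -> exists L : list X, forall x, K x -> exists h, In h L /\ d h x < rho.
Proof.
  intros hK hrho; apply NNPP; intros hno.
  destruct hd as (_ & _ & hsym & htri).
  assert (hnext : forall L : list X, exists x, K x /\ forall h, In h L -> rho <= d h x).
  { intros L; apply NNPP; intros hL; apply hno; exists L; intros x hx.
    apply NNPP; intros hx'; apply hL; exists x; split; [exact hx|].
    intros h hh; apply Rnot_lt_le; intros hlt; apply hx'; eauto. }
  set (next := fun L => proj1_sig (constructive_indefinite_description _ (hnext L))).
  assert (hn : forall L, K (next L) /\ forall h, In h L -> rho <= d h (next L)).
  { intros L; exact (proj2_sig (constructive_indefinite_description _ (hnext L))). }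
  set (Ls := fix Ls k := match k with O => nil | S k => next (Ls k) :: Ls k end).
  assert (hin : forall j k, (j < k)%nat -> In (next (Ls j)) (Ls k)).
  { intros j k hjk; induction hjk; simpl; auto. }
  destruct (hK (fun k => next (Ls k)) (fun k => proj1 (hn _))) as [sg [x [hsg [_ hx]]]].
  destruct (hx (rho / 2)) as [N hN]; [lra|].
  pose proof (hN N (le_n _)); pose proof (hN (S N) (le_S _ _ (le_n _))); simpl in *.
  pose proof (proj2 (hn (Ls (sg (S N)))) _ (hin _ _ (hsg N))).
  pose proof (htri (next (Ls (sg N))) x (next (Ls (sg (S N))))).
  rewrite (hsym x) in *; lra.
Qed.

(** Left invariance makes [d x y] the norm of [x^-1 y]. Conjugation may distort this norm;
    [conj_small] controls the distortion. *)
Definition gnorm {G : group} (d : G -> G -> R) (x : G) : R := d gone x.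

(** * Metric geometry of a discrete cocompact subgroup *)

Section Lattice.
Context {G : group} (d : G -> G -> R)
  (hd : is_metric d) (hli : left_invariant d) (hprop : proper_metric d)
  (htop : topological_group d)
  (Gam : G -> Prop) (hGsub : is_subgroup Gam) (hGdisc : discrete_in d Gam)
  (hGcoc : cocompact d Gam).
Implicit Types x y z g : G.

Local Notation nrm := (gnorm d).

Lemma dist_nrm x y : d x y = nrm (gmul (ginv x) y).
Proof. unfold gnorm; rewrite <- (hli (ginv x) x y), gmulVl; reflexivity. Qed.

Lemma nrm1 : nrm gone = 0.
Proof. apply hd; reflexivity. Qed.

Lemma nrmV x : nrm (ginv x) = nrm x.
Proof.
  destruct hd as (_ & _ & hsym & _).
  unfold gnorm at 2; rewrite hsym, dist_nrm, gmul1r; reflexivity.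
Qed.

Lemma nrmM x y : nrm (gmul x y) <= nrm x + nrm y.
Proof.
  destruct hd as (_ & _ & hsym & htri).
  eapply Rle_trans; [apply (htri gone x)|]; rewrite (dist_nrm x), gmulVK; unfold gnorm; lra.
Qed.

Lemma conj_small g eps : 0 < eps -> exists delta, 0 < delta /\
  forall u, nrm u < delta -> nrm (gmul g (gmul u (ginv g))) < eps.
Proof.
  intros heps; destruct (proj1 htop g (ginv g) eps heps) as [delta [h1 h2]].
  exists delta; split; [exact h1|]; intros u hu.
  assert (h : d (gmul g (ginv g)) (gmul (gmul g u) (ginv g)) < eps).
  { apply h2.
    - rewrite dist_nrm, gmulVK; exact hu.
    - rewrite dist_nrm, gmulVl, nrm1; exact h1. }
  rewrite gmulVr, <- gmulA in h; exact h.
Qed.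

Lemma conj_nrm_le g u : nrm (gmul g (gmul u (ginv g))) <= nrm u + 2 * nrm g.
Proof.
  pose proof (nrmM g (gmul u (ginv g))); pose proof (nrmM u (ginv g)).
  rewrite nrmV in *; lra.
Qed.

Lemma ball_cover (R rho : R) : 0 < rho -> exists L : list G,
  forall x, nrm x <= R -> exists h, In h L /\ nrm (gmul (ginv h) x) < rho.
Proof.
  intros hrho; destruct (totally_bounded d hd _ rho (hprop gone R) hrho) as [L hL].
  exists L; intros x hx; destruct (hL x hx) as [h [h1 h2]].
  rewrite dist_nrm in h2; eauto.
Qed.

(** [cocompact] speaks of [G / Gam]; applying it to [ginv x] passes to the left orbits [Gam x]. *)
Lemma bounded_fundamental_domain : exists R, forall x, exists gam, Gam gam /\ nrm (gmul gam x) <= R.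
Proof.
  destruct hGcoc as [K [hK hcov]].
  destruct (totally_bounded d hd K 1 hK Rlt_0_1) as [L hL].
  assert (hb : exists R, forall h, In h L -> nrm h <= R).
  { clear hL; induction L as [|h L [R hR]]; [exists 0; intros ? []|].
    exists (Rmax (nrm h) R); intros k [<-|hk]; [apply Rmax_l|].
    eapply Rle_trans; [|apply Rmax_r]; auto. }
  destruct hb as [R hR]; exists (R + 1); intros x.
  destruct (hcov (ginv x)) as [k [y [hk [hy e]]]].
  exists y; split; [exact hy|].
  replace (gmul y x) with (ginv k).
  - rewrite nrmV; destruct (hL k hk) as [h [hh hlt]].
    specialize (hR h hh); rewrite dist_nrm in hlt.
    pose proof (nrmM h (gmul (ginv h) k)) as hm; rewrite gmulKV in hm; lra.
  - rewrite <- (ginvK x), e; grp.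
Qed.

(** Take counterexamples with displacement tending to 0. Translating [x] by [Gam], which conjugates
    [gam], keeps the points in a fixed ball, where they subconverge to some [x]. Then [x^-1 gam x]
    tends to the identity, hence so does [gam], contradicting discreteness. *)
Lemma injectivity_radius : exists rho, 0 < rho /\
  forall gam x, Gam gam -> nrm (gmul (ginv x) (gmul gam x)) < rho -> gam = gone.
Proof.
  destruct hGsub as (hG1 & hGM & hGV).
  destruct bounded_fundamental_domain as [R hR].
  apply NNPP; intros hno.
  assert (hseq : forall k : nat, exists p : G * G, Gam (fst p) /\ fst p <> gone /\
    nrm (snd p) <= R /\ nrm (gmul (ginv (snd p)) (gmul (fst p) (snd p))) < / INR (S k)).
  { intros k; apply NNPP; intros hk; apply hno; exists (/ INR (S k)); split.
    { apply Rinv_0_lt_compat, lt_0_INR; lia. }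
    intros gam x hgam hx; apply NNPP; intros hne; apply hk.
    destruct (hR x) as [c [hc hcx]].
    exists (gmul c (gmul gam (ginv c)), gmul c x); simpl; repeat split.
    - auto.
    - intros e; apply hne.
      rewrite <- (gmulVK c gam), <- (gmul1r _ (gmul c gam)), <- (gmulVl _ c), (gmulA _ (gmul c gam)).
      rewrite <- (gmulA _ c gam), e; grp.
    - exact hcx.
    - eapply Rle_lt_trans; [apply Req_le|exact hx]; f_equal; grp. }
  set (p := fun k => proj1_sig (constructive_indefinite_description _ (hseq k))).
  assert (hp : forall k, Gam (fst (p k)) /\ fst (p k) <> gone /\ nrm (snd (p k)) <= R /\
    nrm (gmul (ginv (snd (p k))) (gmul (fst (p k)) (snd (p k)))) < / INR (S k)).
  { intros k; exact (proj2_sig (constructive_indefinite_description _ (hseq k))). }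
  destruct (hprop gone R (fun k => snd (p k))) as [sg [x [hsg [_ hx]]]].
  { intros k; apply hp. }
  destruct (hGdisc gone hG1) as [r [hr hdisc]].
  destruct (conj_small x r hr) as [delta [hdelta hconj]].
  destruct (hx (delta / 4)) as [N1 hN1]; [lra|].
  destruct (archimed_cor1 (delta / 4)) as [N2 [hN2 hN2']]; [lra|].
  set (k := Nat.max N1 N2).
  assert (hsgk : forall j, (j <= sg j)%nat).
  { induction j as [|j IHj]; [lia|]; specialize (hsg j); lia. }
  destruct (hp (sg k)) as (h1 & h2 & _ & h3).
  specialize (hN1 k (Nat.le_max_l _ _)); simpl in hN1.
  set (gam := fst (p (sg k))) in *; set (xk := snd (p (sg k))) in *.
  apply h2, hdisc; [exact h1|].
  assert (hinv : / INR (S (sg k)) < delta / 4).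
  { eapply Rle_lt_trans; [|exact hN2]; apply Rinv_le_contravar; [apply lt_0_INR, hN2'|].
    apply le_INR; specialize (hsgk k); lia. }
  rewrite dist_nrm, <- nrmV in hN1; revert hN1; grp; intros hN1.
  change (nrm gam < r).
  (* [v w v^-1] equals [x^-1 gam x] and has norm at most [nrm w + 2 * nrm v < delta]; conjugating it
     by [x] recovers [gam]. *)
  set (v := gmul (ginv x) xk) in *.
  set (w := gmul (ginv xk) (gmul gam xk)) in *.
  assert (hw : nrm (gmul v (gmul w (ginv v))) < delta).
  { pose proof (conj_nrm_le v w); lra. }
  apply hconj in hw; eapply Rle_lt_trans; [apply Req_le|exact hw].
  f_equal; unfold v, w; grp.
Qed.

(** A substitute for the Haar measure of the image of [z E] in the quotient: an entry of [S] counts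
    once, however many of its translates lie in [z E]. *)
Definition orbit_count (S : list G) (E : G -> Prop) z : R :=
  sumR S (fun s => indic (exists gam, Gam gam /\ E (gmul (ginv z) (gmul gam s)))).

Definition is_net (r : R) (S : list G) : Prop :=
  forall x, exists s gam, In s S /\ Gam gam /\ nrm (gmul (ginv x) (gmul gam s)) <= r.

Definition minimal_net (r : R) (S : list G) : Prop :=
  is_net r S /\ forall S', is_net r S' -> (length S <= length S')%nat.

Lemma orbit_count_ge0 S E z : 0 <= orbit_count S E z.
Proof. apply sumR_ge0; intros; apply indic_ge0. Qed.

Lemma orbit_count_le S (E E' : G -> Prop) z :
  (forall e, E e -> E' e) -> orbit_count S E z <= orbit_count S E' z.
Proof.
  intros h; apply sumR_le; intros s _; apply indic_le; intros [gam [h1 h2]]; eauto.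
Qed.

Lemma minimal_net_exists (r : R) : 0 < r -> exists S, minimal_net r S.
Proof.
  intros hr; destruct bounded_fundamental_domain as [R hR].
  destruct (ball_cover R r hr) as [L hL].
  assert (hnet : exists k, exists S, is_net r S /\ length S = k).
  { exists (length L), L; split; [|reflexivity]; intros x.
    destruct (hR x) as [gam [hgam hx]]; destruct (hL _ hx) as [h [hh hlt]].
    exists h, (ginv gam); split; [exact hh|split; [apply hGsub, hgam|]].
    rewrite <- nrmV in hlt; revert hlt; grp; lra. }
  destruct (dec_inh_nat_subset_has_unique_least_element _ (fun k => classic _) hnet)
    as [k [[[S [hS <-]] hmin] _]].
  exists S; split; [exact hS|]; intros S' hS'; apply hmin; eauto.
Qed.

(* If [z E] contained more points of the net than [z' E2], replacing the former by a
   translate of the latter would give a smaller net. *)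
Lemma orbit_count_transport (rho r : R) (S : list G) (E E2 : G -> Prop) z z' :
  (forall gam x, Gam gam -> nrm (gmul (ginv x) (gmul gam x)) < rho -> gam = gone) ->
  minimal_net r S ->
  (forall e u, E e -> nrm u <= 2 * r -> E2 (gmul e u)) ->
  (forall e e', E2 e -> E2 e' -> nrm (gmul (ginv e) e') < rho) ->
  orbit_count S E z <= orbit_count S E2 z'.
Proof.
  intros hinj [hnet hmin] hE hdiam.
  destruct hGsub as (hG1 & hGM & hGV).
  set (P1 := fun s => exists gam, Gam gam /\ E (gmul (ginv z) (gmul gam s))).
  set (P2 := fun s => exists gam, Gam gam /\ E2 (gmul (ginv z') (gmul gam s))).
  assert (hch : forall s, exists gam, P2 s -> Gam gam /\ E2 (gmul (ginv z') (gmul gam s))).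
  { intros s; destruct (classic (P2 s)) as [[gam h]|h]; [eauto|exists gone; tauto]. }
  set (c := fun s => proj1_sig (constructive_indefinite_description _ (hch s))).
  assert (hc : forall s, P2 s -> Gam (c s) /\ E2 (gmul (ginv z') (gmul (c s) s))).
  { intros s; exact (proj2_sig (constructive_indefinite_description _ (hch s))). }
  clearbody c.
  set (p1 := fun s => if excluded_middle_informative (P1 s) then true else false).
  set (p2 := fun s => if excluded_middle_informative (P2 s) then true else false).
  (* The points whose orbits meet [z E] are dropped; those whose orbits meet [z' E2] contribute a
     copy moved by [z z'^-1]. *)
  set (S' := filter (fun s => negb (p1 s)) S ++
    map (fun s => gmul z (gmul (ginv z') (gmul (c s) s))) (filter p2 S)).
  assert (hS' : is_net r S').
  { intros x; destruct (hnet x) as [s [gam [hs [hgam hx]]]].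
    destruct (classic (P1 s)) as [[gam' [hgam' he]]|hs1].
    - destruct (hnet (gmul z' (gmul (ginv z) (gmul gam' (gmul (ginv gam) x)))))
        as [s2 [gam2 [hs2 [hgam2 hy]]]].
      assert (h2 : E2 (gmul (ginv z') (gmul gam2 s2))).
      { replace (gmul (ginv z') (gmul gam2 s2)) with
          (gmul (gmul (ginv z) (gmul gam' s))
            (gmul (ginv (gmul (ginv x) (gmul gam s)))
               (gmul (ginv (gmul z' (gmul (ginv z) (gmul gam' (gmul (ginv gam) x)))))
                 (gmul gam2 s2)))) by grp.
        apply hE; [exact he|].
        eapply Rle_trans; [apply nrmM|]; rewrite nrmV; lra. }
      assert (hP2 : P2 s2) by (exists gam2; auto).
      destruct (hc s2 hP2) as [hc1 hc2].
      (* Both [gam2] and the chosen [c s2] bring [s2] into [z' E2], a set of diameter below the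
         injectivity radius, so they coincide. *)
      assert (ec : gmul (ginv gam2) (c s2) = gone).
      { apply (hinj _ s2); [auto|].
        pose proof (hdiam _ _ h2 hc2) as hlt; revert hlt; grp; tauto. }
      assert (ec' : c s2 = gam2).
      { rewrite <- (gmulKV gam2 (c s2)), ec, gmul1r; reflexivity. }
      exists (gmul z (gmul (ginv z') (gmul (c s2) s2))), (gmul gam (ginv gam')).
      split; [|split; [auto|]].
      + apply in_or_app; right; apply in_map_iff; exists s2; split; [reflexivity|].
        apply filter_In; split; [exact hs2|]; unfold p2.
        destruct (excluded_middle_informative (P2 s2)); tauto.
      + rewrite ec'; revert hy; grp; tauto.
    - exists s, gam; split; [|tauto].
      apply in_or_app; left; apply filter_In; split; [exact hs|]; unfold p1.
      destruct (excluded_middle_informative (P1 s)); tauto. }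
  apply hmin in hS'; unfold S' in hS'; rewrite length_app, length_map in hS'.
  pose proof (filter_length p1 S) as hlen.
  unfold orbit_count; fold P1 P2.
  change (sumR S (fun s => indic (P1 s)) <= sumR S (fun s => indic (P2 s))).
  rewrite <- !length_filter_indic; apply le_INR; fold p1 p2; lia.
Qed.

(** The [rho']-ball is covered by finitely many small balls, each of which transports into the
    [rho'']-ball. Their number [D] depends on neither the net nor its scale [r]. *)
Lemma orbit_count_ball_le (rho' rho'' : R) : 0 < rho'' ->
  exists D r0, 0 <= D /\ 0 < r0 /\ forall r S z z', r <= r0 -> minimal_net r S ->
    orbit_count S (fun e => nrm e <= rho') z <= D * orbit_count S (fun e => nrm e <= rho'') z'.
Proof.
  intros hrho''; destruct injectivity_radius as [rho [hrho hinj]].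
  (* With [2 * r <= rho1], thickening a [rho1]-ball stays within radius [2 * rho1], which is at most
     [rho''] and gives differences of norm below [rho]. *)
  set (rho1 := Rmin rho'' (rho / 4) / 2).
  assert (h1 : 0 < rho1) by (unfold rho1; pose proof (Rmin_glb_lt rho'' (rho / 4) 0); lra).
  assert (h2 : 2 * rho1 <= rho'') by (unfold rho1; pose proof (Rmin_l rho'' (rho / 4)); lra).
  assert (h3 : 4 * rho1 < rho) by (unfold rho1; pose proof (Rmin_r rho'' (rho / 4)); lra).
  destruct (ball_cover rho' rho1 h1) as [L hL].
  exists (INR (length L)), (rho1 / 2); split; [apply pos_INR|split; [lra|]].
  intros r S z z' hr hS.
  eapply Rle_trans with (sumR L (fun h => orbit_count S (fun e => nrm e <= rho1) (gmul z h))).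
  - unfold orbit_count; rewrite sumR_swap; apply sumR_le; intros s _.
    unfold indic at 1; destruct (excluded_middle_informative _) as [[gam [hg hn]]|_].
    + destruct (hL _ hn) as [h [hh hlt]].
      set (f := fun h => indic (exists gam, Gam gam /\
        nrm (gmul (ginv (gmul z h)) (gmul gam s)) <= rho1)).
      replace 1 with (f h); [apply (sumR_term_le L f); [|exact hh]|].
      * intros; apply indic_ge0.
      * apply indic_true; exists gam; split; [exact hg|]; revert hlt; grp; lra.
    + apply sumR_ge0; intros; apply indic_ge0.
  - rewrite <- sumR_const; apply sumR_le; intros h _.
    eapply Rle_trans; [|apply orbit_count_le; intros e he; exact (Rle_trans _ _ _ he h2)].
    apply (orbit_count_transport rho r); [exact hinj|exact hS| |].
    + intros e u he hu; eapply Rle_trans; [apply nrmM|]; lra.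
    + intros e e' he he'; eapply Rle_lt_trans; [apply nrmM|]; rewrite nrmV; lra.
Qed.

(** A ball of radius [R] meets every orbit, so its count is the whole length of the net. *)
Lemma net_length_le (rho : R) : 0 < rho ->
  exists D r0, 0 <= D /\ 0 < r0 /\ forall r S z, r <= r0 -> minimal_net r S ->
    INR (length S) <= D * orbit_count S (fun e => nrm e <= rho) z.
Proof.
  intros hrho; destruct bounded_fundamental_domain as [R hR].
  destruct (orbit_count_ball_le R rho hrho) as [D [r0 [hD [hr0 h]]]].
  exists D, r0; split; [exact hD|split; [exact hr0|]]; intros r S z hr hS.
  eapply Rle_trans; [|apply (h r S gone z hr hS)].
  rewrite <- (Rmult_1_r (INR (length S))), <- sumR_const; unfold orbit_count.
  apply sumR_le; intros s _; rewrite indic_true; [lra|].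
  destruct (hR s) as [gam [hg hn]]; exists gam; split; [exact hg|].
  rewrite ginv1, gmul1l; exact hn.
Qed.

Lemma sumR_seq_shift (f : nat -> R) (Q : nat) :
  sumR (seq 0 Q) (fun m => f (S m)) + f 0%nat = sumR (seq 0 Q) f + f Q.
Proof.
  induction Q as [|Q IH]; [simpl; lra|].
  rewrite seq_S, !sumR_app; simpl; lra.
Qed.

(* Summing the counts over [Q] nested thickenings makes the boundary error of a single
   transport relatively small, of order [D / Q]. *)
Lemma layered_count_le (rho r : R) (S0 : list G) (E : nat -> G -> Prop) (Q : nat) (D : R) z z' :
  (forall gam x, Gam gam -> nrm (gmul (ginv x) (gmul gam x)) < rho -> gam = gone) ->
  minimal_net r S0 -> 0 <= r -> 0 <= D ->
  (forall m e u, E m e -> nrm u <= 2 * r -> E (S m) (gmul e u)) ->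
  (forall e e', E Q e -> E Q e' -> nrm (gmul (ginv e) e') < rho) ->
  (forall z z', orbit_count S0 (E Q) z <= D * orbit_count S0 (E 0%nat) z') ->
  INR Q * sumR (seq 0 Q) (fun m => orbit_count S0 (E m) z)
  <= (INR Q + D) * sumR (seq 0 Q) (fun m => orbit_count S0 (E m) z').
Proof.
  intros hinj hS hr hD hE hdiam hcomp.
  assert (hmono : forall m k e, E m e -> E (m + k)%nat e).
  { intros m k e he; induction k as [|k IHk]; [rewrite Nat.add_0_r; exact he|].
    rewrite Nat.add_succ_r, <- (gmul1r _ e); apply hE; [exact IHk|rewrite nrm1; lra]. }
  set (T := fun z => sumR (seq 0 Q) (fun m => orbit_count S0 (E m) z)).
  change (INR Q * T z <= (INR Q + D) * T z').
  assert (h1 : T z <= T z' + orbit_count S0 (E Q) z').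
  { pose proof (sumR_seq_shift (fun m => orbit_count S0 (E m) z') Q) as hs.
    pose proof (orbit_count_ge0 S0 (E 0%nat) z').
    assert (T z <= sumR (seq 0 Q) (fun m => orbit_count S0 (E (S m)) z')); [|unfold T in *; lra].
    apply sumR_le; intros m hm; apply in_seq in hm.
    apply (orbit_count_transport rho r); [exact hinj|exact hS|apply hE|].
    intros e e' he he'; apply hdiam; replace Q with (S m + (Q - S m))%nat by lia;
      apply hmono; assumption. }
  assert (h2 : INR Q * orbit_count S0 (E 0%nat) z' <= T z').
  { rewrite <- (length_seq Q 0) at 1; rewrite <- sumR_const; apply sumR_le; intros m _.
    apply orbit_count_le; intros e he; exact (hmono 0%nat m e he). }
  pose proof (hcomp z' z') as h3; pose proof (pos_INR Q).
  apply Rmult_le_compat_l with (r := INR Q) in h1; [|lra].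
  apply Rmult_le_compat_l with (r := INR Q) in h3; [|lra].
  apply Rmult_le_compat_l with (r := D) in h2; [|lra].
  lra.
Qed.

Definition nearly_constant {A : Type} (l : list A) (delta : R) (f : A -> R) : Prop :=
  forall a a', In a l -> In a' l -> f a <= (1 + delta) * f a'.

(* The kernel counts the radii [R0 + m h], [m < Q], at which [y] is close to [x g] modulo
   [Gam]. Its column sums are orbit counts for the shapes [g B g^-1]; that both these and
   the balls are counted evenly by one net replaces the invariance of Haar measure under
   left and right translations. *)
Lemma nearly_bistochastic_kernel g (eta delta : R) : 0 < eta -> 0 < delta ->
  exists r0, 0 < r0 /\ forall r S0, 0 < r -> r <= r0 -> minimal_net r S0 ->
    exists K : G -> G -> R,
      (forall x y, 0 <= K x y) /\
      (forall x y, K x y <> 0 -> exists gam, Gam gam /\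
         nrm (gmul (ginv (gmul x g)) (gmul gam y)) <= eta) /\
      nearly_constant S0 delta (fun x => sumR S0 (K x)) /\
      nearly_constant S0 delta (fun y => sumR S0 (fun x => K x y)) /\
      0 < sumR S0 (fun x => sumR S0 (K x)).
Proof.
  intros heta hdelta; destruct injectivity_radius as [rho [hrho hinj]].
  destruct (conj_small g rho hrho) as [dg [hdg hconjg]].
  (* All layers have radii between [R0] and [2 * R0]. Thus the kernel is supported within [eta], and
     differences of elements have norm at most [4 * R0], below both [rho] and [dg]; the latter
     serves the shapes conjugated by [g]. *)
  set (R0 := Rmin eta (Rmin rho dg) / 5).
  assert (hR0 : 0 < R0) by (unfold R0; pose proof (Rmin_glb_lt eta (Rmin rho dg) 0);
    pose proof (Rmin_glb_lt rho dg 0); lra).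
  assert (hR0' : 5 * R0 <= eta /\ 5 * R0 <= rho /\ 5 * R0 <= dg).
  { unfold R0; pose proof (Rmin_l eta (Rmin rho dg)); pose proof (Rmin_r eta (Rmin rho dg)).
    pose proof (Rmin_l rho dg); pose proof (Rmin_r rho dg); lra. }
  (* The innermost conjugated shape contains the ball of radius [rho2 / 2]. *)
  destruct (conj_small (ginv g) R0 hR0) as [rho2 [hrho2 hconj0]].
  destruct (orbit_count_ball_le (2 * R0) R0 hR0) as [D1 [r1 [hD1 [hr1 hcomp1]]]].
  destruct (orbit_count_ball_le (2 * R0 + 2 * nrm g) (rho2 / 2)) as [D2 [r2 [hD2 [hr2 hcomp2]]]];
    [lra|].
  (* With this many layers the relative errors [D1 / Q] and [D2 / Q] are at most [delta]. *)
  destruct (INR_unbounded ((D1 + D2) / delta)) as [Q hQ].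
  assert (hQ0 : 0 < INR Q).
  { eapply Rle_lt_trans; [|exact hQ]; apply Rmult_le_pos; [lra|].
    apply Rlt_le, Rinv_0_lt_compat, hdelta. }
  assert (hQD : D1 + D2 <= delta * INR Q).
  { apply Rmult_lt_compat_l with (r := delta) in hQ; [|exact hdelta].
    replace (delta * ((D1 + D2) / delta)) with (D1 + D2) in hQ by (field; lra); lra. }
  set (h := R0 / INR Q).
  assert (hh : 0 < h) by (apply Rdiv_lt_0_compat; assumption).
  assert (hQh : INR Q * h = R0) by (unfold h; field; lra).
  assert (hhR : h <= R0).
  { assert (hQ1 : 1 <= INR Q).
    { apply (le_INR 1), INR_lt; exact hQ0. }
    apply Rmult_le_compat_r with (r := h) in hQ1; lra. }
  (* Below [rho3], a perturbation of a conjugated shape costs at most one layer width [h]. *)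
  destruct (conj_small (ginv g) h hh) as [rho3 [hrho3 hconjh]].
  set (r0 := Rmin (Rmin r1 r2) (Rmin (h / 2) (rho3 / 3))).
  assert (hr0 : 0 < r0) by (unfold r0; repeat apply Rmin_glb_lt; lra).
  assert (hr0' : r0 <= r1 /\ r0 <= r2 /\ r0 <= h / 2 /\ r0 <= rho3 / 3).
  { unfold r0; pose proof (Rmin_l (Rmin r1 r2) (Rmin (h / 2) (rho3 / 3))).
    pose proof (Rmin_r (Rmin r1 r2) (Rmin (h / 2) (rho3 / 3))).
    pose proof (Rmin_l r1 r2); pose proof (Rmin_r r1 r2).
    pose proof (Rmin_l (h / 2) (rho3 / 3)); pose proof (Rmin_r (h / 2) (rho3 / 3)); lra. }
  assert (hlayer : forall m, (m < Q)%nat -> R0 + INR m * h <= 2 * R0).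
  { intros m hm; apply lt_INR in hm.
    apply Rmult_lt_compat_r with (r := h) in hm; [lra|exact hh]. }
  exists r0; split; [exact hr0|]; intros r S0 hr hrr hS.
  set (B := fun m (e : G) => nrm e <= R0 + INR m * h).
  set (B' := fun m (e : G) => nrm (gmul (ginv g) (gmul e g)) <= R0 + INR m * h).
  set (K := fun x y => sumR (seq 0 Q) (fun m => indic (exists gam, Gam gam /\
    B m (gmul (ginv (gmul x g)) (gmul gam y))))).
  assert (hfin : forall T T' D, 0 <= T' -> D <= D1 + D2 ->
    INR Q * T <= (INR Q + D) * T' -> T <= (1 + delta) * T').
  { intros T T' D hT' hD hTT; apply Rmult_le_reg_l with (INR Q); [exact hQ0|].
    eapply Rle_trans; [exact hTT|].
    replace (INR Q * ((1 + delta) * T')) with ((INR Q + delta * INR Q) * T') by ring.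
    apply Rmult_le_compat_r; lra. }
  assert (hK0 : forall x y, 0 <= K x y).
  { intros; apply sumR_ge0; intros; apply indic_ge0. }
  assert (hrow : forall x, sumR S0 (K x) =
    sumR (seq 0 Q) (fun m => orbit_count S0 (B m) (gmul x g))).
  { intros x; unfold K; rewrite sumR_swap; reflexivity. }
  (* Inverting both [gam] and the group element reads the kernel from [y]: the condition on [x] is
     that its orbit meet the conjugated shape [B' m] placed at [y g^-1]. *)
  assert (hcol : forall y, sumR S0 (fun x => K x y) =
    sumR (seq 0 Q) (fun m => orbit_count S0 (B' m) (gmul y (ginv g)))).
  { intros y; unfold K; rewrite sumR_swap; apply sumR_ext; intros m _.
    apply sumR_ext; intros x _; apply indic_ext; unfold B, B'.
    split; intros [gam [hg hn]]; exists (ginv gam); (split; [apply hGsub, hg|]);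
      rewrite <- nrmV; revert hn; grp; tauto. }
  exists K; split; [exact hK0|split; [|split; [|split]]].
  - intros x y hxy; apply NNPP; intros hno; apply hxy; unfold K.
    rewrite (sumR_ext _ _ (fun _ => 0)), sumR_0; [reflexivity|].
    intros m hm; apply in_seq in hm; apply indic_false; intros [gam [hg hn]].
    apply hno; exists gam; split; [exact hg|]; unfold B in hn.
    specialize (hlayer m ltac:(lia)); lra.
  - intros x x' _ _; rewrite !hrow; apply (hfin _ _ D1);
      [apply sumR_ge0; intros; apply orbit_count_ge0|lra|].
    apply (layered_count_le rho r); [exact hinj|exact hS|lra|exact hD1| | |].
    + intros m e u he hu; unfold B in *; rewrite S_INR.
      eapply Rle_trans; [apply nrmM|]; lra.
    + unfold B; intros e e' he he'; eapply Rle_lt_trans; [apply nrmM|]; rewrite nrmV; lra.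
    + intros z z'; eapply Rle_trans; [apply (orbit_count_le _ _ (fun e => nrm e <= 2 * R0))|].
      { unfold B; intros e he; lra. }
      eapply Rle_trans; [apply (hcomp1 r S0 z z'); [lra|exact hS]|].
      apply Rmult_le_compat_l; [exact hD1|]; apply orbit_count_le; unfold B; simpl; intros; lra.
  - intros y y' _ _; rewrite !hcol; apply (hfin _ _ D2);
      [apply sumR_ge0; intros; apply orbit_count_ge0|lra|].
    apply (layered_count_le rho r); [exact hinj|exact hS|lra|exact hD2| | |].
    + intros m e u he hu; unfold B' in *; rewrite S_INR.
      replace (gmul (ginv g) (gmul (gmul e u) g)) with
        (gmul (gmul (ginv g) (gmul e g)) (gmul (ginv g) (gmul u (ginv (ginv g))))) by grp.
      assert (hu' : nrm u < rho3) by lra; apply hconjh in hu'.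
      eapply Rle_trans; [apply nrmM|]; lra.
    + unfold B'; intros e e' he he'.
      replace (gmul (ginv e) e') with (gmul g (gmul
        (gmul (ginv (gmul (ginv g) (gmul e g))) (gmul (ginv g) (gmul e' g))) (ginv g))) by grp.
      apply hconjg; eapply Rle_lt_trans; [apply nrmM|]; rewrite nrmV; lra.
    + intros z z'; eapply Rle_trans;
        [apply (orbit_count_le _ _ (fun e => nrm e <= 2 * R0 + 2 * nrm g))|].
      { unfold B'; intros e he; pose proof (conj_nrm_le g (gmul (ginv g) (gmul e g))) as hc.
        revert hc; grp; lra. }
      eapply Rle_trans; [apply (hcomp2 r S0 z z'); [lra|exact hS]|].
      apply Rmult_le_compat_l; [exact hD2|]; apply orbit_count_le; unfold B'; simpl.
      intros e he; assert (he' : nrm e < rho2) by lra; apply hconj0 in he'.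
      rewrite ginvK in he'; lra.
  (* A net point within [r] of [x g] lies in every layer, already in the innermost. *)
  - destruct hS as [hnet _]; destruct (hnet gone) as [x [_ [hx _]]].
    destruct (hnet (gmul x g)) as [y [gam [hy [hgam hn]]]].
    eapply Rlt_le_trans with (K x y).
    + apply Rlt_le_trans with 1; [lra|].
      unfold K; set (f := fun m => indic (exists gam, Gam gam /\
        B m (gmul (ginv (gmul x g)) (gmul gam y)))).
      replace 1 with (f 0%nat); [apply (sumR_term_le (seq 0 Q) f)|].
      * intros; apply indic_ge0.
      * apply in_seq; split; [lia|]; apply INR_lt; simpl; exact hQ0.
      * apply indic_true; exists gam; split; [exact hgam|]; unfold B; simpl.
        lra.
    + eapply Rle_trans; [apply (sumR_term_le S0 (K x)); [intros; apply hK0|exact hy]|].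
      apply (sumR_term_le S0 (fun x => sumR S0 (K x))); [|exact hx].
      intros; apply sumR_ge0; intros; apply hK0.
Qed.

(** * Refutation of the dual certificate *)

Lemma nearly_constant_mean {A : Type} (l : list A) (delta : R) (f : A -> R) (a : A) :
  0 <= delta -> (forall b, 0 <= f b) -> nearly_constant l delta f -> In a l ->
  Rabs (INR (length l) * f a - sumR l f) <= delta * sumR l f.
Proof.
  intros hdelta hf hc ha.
  assert (h1 : INR (length l) * f a <= (1 + delta) * sumR l f).
  { rewrite <- sumR_const, <- sumR_scal; apply sumR_le; auto. }
  assert (h2 : sumR l f <= (1 + delta) * (INR (length l) * f a)).
  { replace ((1 + delta) * (INR (length l) * f a)) with (INR (length l) * ((1 + delta) * f a))
      by ring.
    rewrite <- sumR_const; apply sumR_le; auto. }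
  assert (h3 : 0 <= INR (length l) * f a) by (apply Rmult_le_pos; [apply pos_INR|apply hf]).
  apply Rabs_le; split; [|lra].
  (* For [delta < 1] the lower bound follows from [h2] and [(1 - delta) * (1 + delta) <= 1]; for
     [delta >= 1] it is at most 0. *)
  destruct (Rle_dec 1 delta) as [h|h]; [|nra].
  assert (0 <= sumR l f) by (apply sumR_ge0; auto). nra.
Qed.

(** Summing [A x + B y] against [K] pairs [A] with the row sums and [B] with the column sums. Both
    have total [T], so both are close to the same constant [T / length l]; replacing them by it
    costs at most [C * delta * T] for each of [A] and [B]. *)
Lemma bistochastic_pairing (l : list G) (delta C : R) (K : G -> G -> R) (A B : G -> R) :
  0 <= delta -> (forall x y, 0 <= K x y) ->
  nearly_constant l delta (fun x => sumR l (K x)) ->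
  nearly_constant l delta (fun y => sumR l (fun x => K x y)) ->
  0 < sumR l (fun x => sumR l (K x)) ->
  (forall x, Rabs (A x) <= C) -> (forall x, Rabs (B x) <= C) ->
  (forall x y, K x y <> 0 -> 0 <= A x + B y) ->
  0 <= sumR l (fun x => A x + B x) + 2 * C * delta * INR (length l).
Proof.
  intros hdelta hK hrow hcol hT hA hB hAB.
  set (row := fun x => sumR l (K x)) in *.
  set (col := fun y => sumR l (fun x => K x y)) in *.
  set (T := sumR l row) in *.
  assert (hT' : sumR l col = T) by (symmetry; apply sumR_swap).
  assert (hsum : 0 <= sumR l (fun x => A x * row x) + sumR l (fun y => B y * col y)).
  { replace (sumR l (fun x => A x * row x) + sumR l (fun y => B y * col y)) with
      (sumR l (fun x => sumR l (fun y => K x y * (A x + B y)))).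
    - apply sumR_ge0; intros x _; apply sumR_ge0; intros y _.
      destruct (Req_dec (K x y) 0) as [e|e]; [rewrite e; lra|].
      apply Rmult_le_pos; auto.
    - rewrite (sumR_ext l _ (fun x => A x * row x + sumR l (fun y => B y * K x y))).
      + rewrite sumR_plus; f_equal; rewrite sumR_swap; apply sumR_ext; intros y _.
        apply sumR_scal.
      + intros x _; rewrite (sumR_ext l _ (fun y => A x * K x y + B y * K x y)) by
          (intros; ring).
        rewrite sumR_plus, sumR_scal; reflexivity. }
  assert (hbound : forall (f F : G -> R), (forall x, Rabs (F x) <= C) ->
    (forall x, 0 <= f x) -> sumR l f = T -> nearly_constant l delta f ->
    INR (length l) * sumR l (fun x => F x * f x)
    <= T * sumR l F + INR (length l) * (C * (delta * T))).
  { intros f F hF hf hfT hc.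
    rewrite <- (sumR_const l (C * (delta * T))), <- (sumR_scal l (fun x => F x * f x)),
      <- (sumR_scal l F), <- sumR_plus; apply sumR_le; intros x hx.
    pose proof (nearly_constant_mean l delta f x hdelta hf hc hx) as hm; rewrite hfT in hm.
    specialize (hF x).
    assert (hp : Rabs (F x * (INR (length l) * f x - T)) <= C * (delta * T)).
    { rewrite Rabs_mult; apply Rmult_le_compat; auto using Rabs_pos. }
    pose proof (Rle_abs (F x * (INR (length l) * f x - T))); lra. }
  pose proof (hbound row A hA ltac:(intros; apply sumR_ge0; auto) eq_refl hrow) as h1.
  pose proof (hbound col B hB ltac:(intros; apply sumR_ge0; auto) hT' hcol) as h2.
  rewrite sumR_plus; pose proof (pos_INR (length l)) as hl.
  apply Rmult_le_compat_l with (r := INR (length l)) in hsum; [|exact hl].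
  apply Rmult_le_reg_l with T; [exact hT|]. lra.
Qed.

Lemma uniform_radius (n : nat) (P : nat -> R -> Prop) :
  (forall i, (i < n)%nat -> exists r0, 0 < r0 /\ forall r, 0 < r -> r <= r0 -> P i r) ->
  exists r0, 0 < r0 /\ forall r, 0 < r -> r <= r0 -> forall i, (i < n)%nat -> P i r.
Proof.
  induction n as [|n IH]; intros h.
  - exists 1; split; [lra|]; intros; lia.
  - destruct IH as [r1 [hr1 h1]]; [intros; apply h; lia|].
    destruct (h n) as [r2 [hr2 h2]]; [lia|].
    exists (Rmin r1 r2); split; [apply Rmin_glb_lt; assumption|].
    intros r hr hr' i hi; pose proof (Rmin_l r1 r2); pose proof (Rmin_r r1 r2).
    destruct (Nat.eq_dec i n) as [->|]; [apply h2; lra|apply h1; [lra|lra|lia]].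
Qed.

Lemma conj_small_uniform (n : nat) (g : nat -> G) eps : 0 < eps ->
  exists delta, 0 < delta /\ delta <= eps /\
    forall i u, (i < n)%nat -> nrm u <= delta -> nrm (gmul (g i) (gmul u (ginv (g i)))) <= eps.
Proof.
  intros heps.
  destruct (uniform_radius n (fun i r => forall u, nrm u <= r ->
    nrm (gmul (g i) (gmul u (ginv (g i)))) <= eps)) as [r0 [hr0 h]].
  - intros i _; destruct (conj_small (g i) eps heps) as [delta [hdelta hc]].
    exists (delta / 2); split; [lra|]; intros r _ hr u hu; apply Rlt_le, hc; lra.
  - exists (Rmin r0 eps); split; [apply Rmin_glb_lt; assumption|split; [apply Rmin_r|]].
    intros i u hi hu; apply (h (Rmin r0 eps)); [apply Rmin_glb_lt; assumption|apply Rmin_l|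
      exact hi|exact hu].
Qed.

(** Weight each cell by its number of net points. The vertex inequalities then sum to at most 0 and
    include at least [m0] from cell 0, while [bistochastic_pairing] bounds each generator's sum
    below by a small multiple of [length S0], which is itself at most [D * m0]. *)
Lemma dual_certificate_absurd (n M : nat) (g t : nat -> G) (rho eps : R) (alpha beta : nat -> nat -> R) :
  0 < rho -> 3 * rho <= eps ->
  (forall i u, (i < n)%nat -> nrm u <= rho ->
     3 * nrm (gmul (ginv (g i)) (gmul u (g i))) <= eps) ->
  (0 < M)%nat -> t 0%nat = gone ->
  (forall x, exists j, (j < M)%nat /\
     exists gam, Gam gam /\ nrm (gmul (ginv (t j)) (gmul gam x)) <= rho) ->
  (forall i j k, (i < n)%nat -> (j < M)%nat -> (k < M)%nat ->
     (exists gam, Gam gam /\ nrm (gmul (ginv (gmul (t j) (g i))) (gmul gam (t k))) <= eps) ->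
     0 <= alpha i j + beta i k) ->
  (forall j, (j < M)%nat ->
     indic (j = 0%nat) + sumR (seq 0 n) (fun i => alpha i j + beta i j) <= 0) ->
  False.
Proof.
  intros hrho heps hconj hM ht0 hcover hedge hvtx.
  destruct hGsub as (hG1 & hGM & hGV).
  (* Points near the orbit of the identity are forced into cell 0, so that this cell receives at
     least [m0] net points. *)
  assert (hcell : forall x, exists j, (j < M)%nat /\
    (exists gam, Gam gam /\ nrm (gmul (ginv (t j)) (gmul gam x)) <= rho) /\
    ((exists gam, Gam gam /\ nrm (gmul (ginv gone) (gmul gam x)) <= rho) -> j = 0%nat)).
  { intros x; destruct (classic (exists gam, Gam gam /\
      nrm (gmul (ginv gone) (gmul gam x)) <= rho)) as [h|h].
    - exists 0%nat; rewrite ht0; auto.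
    - destruct (hcover x) as [j [hj hx]]; exists j; tauto. }
  set (cell := fun x => proj1_sig (constructive_indefinite_description _ (hcell x))).
  assert (hc : forall x, (cell x < M)%nat /\
    (exists gam, Gam gam /\ nrm (gmul (ginv (t (cell x))) (gmul gam x)) <= rho) /\
    ((exists gam, Gam gam /\ nrm (gmul (ginv gone) (gmul gam x)) <= rho) -> cell x = 0%nat)).
  { intros x; exact (proj2_sig (constructive_indefinite_description _ (hcell x))). }
  clearbody cell.
  set (w := fun e : nat * nat =>
    Rabs (alpha (fst e) (snd e)) + Rabs (beta (fst e) (snd e))).
  set (C := sumR (list_prod (seq 0 n) (seq 0 M)) w).
  assert (hw : forall e, 0 <= w e).
  { intros e; unfold w; pose proof (Rabs_pos (alpha (fst e) (snd e)));
      pose proof (Rabs_pos (beta (fst e) (snd e))); lra. }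
  assert (hC0 : 0 <= C) by (apply sumR_ge0; auto).
  assert (hC : forall i j, (i < n)%nat -> (j < M)%nat ->
    Rabs (alpha i j) <= C /\ Rabs (beta i j) <= C).
  { intros i j hi hj.
    assert (h : w (i, j) <= C).
    { apply sumR_term_le; [auto|]; apply in_prod_iff; rewrite !in_seq; lia. }
    unfold w in h; simpl in h; pose proof (Rabs_pos (alpha i j));
      pose proof (Rabs_pos (beta i j)); lra. }
  destruct (net_length_le rho hrho) as [D [r1 [hD [hr1 hlen]]]].
  assert (hnCD : 0 <= 2 * INR n * C * D).
  { repeat apply Rmult_le_pos; auto using pos_INR; lra. }
  (* The total error [2 * n * C * delta * D * m0] is then smaller than [m0]. *)
  set (delta := / (2 * INR n * C * D + 1)).
  assert (hdelta : 0 < delta) by (apply Rinv_0_lt_compat; lra).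
  assert (hdelta1 : delta * (2 * INR n * C * D) < 1).
  { assert (delta * (2 * INR n * C * D + 1) = 1) by (unfold delta; field; lra). lra. }
  destruct (uniform_radius n (fun i r => forall S0, minimal_net r S0 ->
    0 <= sumR S0 (fun x => alpha i (cell x) + beta i (cell x))
         + 2 * C * delta * INR (length S0))) as [r2 [hr2 hker]].
  { intros i hi.
    destruct (nearly_bistochastic_kernel (g i) rho delta hrho hdelta) as [r0 [hr0 hK]].
    exists r0; split; [exact hr0|]; intros r hr hrr S0 hS.
    destruct (hK r S0 hr hrr hS) as [K [h0 [hadj [hrow [hcol hT]]]]].
    apply (bistochastic_pairing S0 delta C K (fun x => alpha i (cell x))
      (fun x => beta i (cell x))); auto; try lra.
    - intros x; apply hC; [exact hi|apply hc].
    - intros x; apply hC; [exact hi|apply hc].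
    - intros x y hxy; apply hedge; [exact hi|apply hc|apply hc|].
      destruct (hadj x y hxy) as [gam [hgam hn]].
      destruct (hc x) as (_ & [gam1 [hgam1 hn1]] & _).
      destruct (hc y) as (_ & [gam2 [hgam2 hn2]] & _).
      (* The displacement between the cell centres has three factors, each of norm at most
         [eps / 3]: from the centre to [x], conjugated by [g i]; the kernel step [q]; and from [y]
         to its centre. *)
      exists (gmul gam1 (gmul gam (ginv gam2))); split; [auto|].
      apply (hconj i _ hi) in hn1; rewrite <- nrmV in hn2.
      set (p := gmul (ginv (g i)) (gmul (gmul (ginv (t (cell x))) (gmul gam1 x)) (g i))) in *.
      set (q := gmul (ginv (gmul x (g i))) (gmul gam y)) in *.
      set (s := ginv (gmul (ginv (t (cell y))) (gmul gam2 y))) in *.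
      replace (gmul (ginv (gmul (t (cell x)) (g i)))
        (gmul (gmul gam1 (gmul gam (ginv gam2))) (t (cell y)))) with (gmul p (gmul q s))
        by (unfold p, q, s; grp).
      pose proof (nrmM p (gmul q s)); pose proof (nrmM q s); lra. }
  set (r := Rmin r1 r2).
  assert (hr : 0 < r) by (apply Rmin_glb_lt; assumption).
  destruct (minimal_net_exists r hr) as [S0 hS].
  specialize (hlen r S0 gone (Rmin_l _ _) hS).
  set (m0 := orbit_count S0 (fun e => nrm e <= rho) gone) in *.
  assert (hS1 : 0 < INR (length S0)).
  { destruct (proj1 hS gone) as [s [_ [hs _]]]; destruct S0; [contradiction|].
    apply lt_0_INR; simpl; lia. }
  assert (hm0 : 0 < m0).
  { pose proof (orbit_count_ge0 S0 (fun e => nrm e <= rho) gone) as h; fold m0 in h.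
    destruct h as [h|h]; [exact h|]; rewrite <- h in hlen; lra. }
  assert (h1 : m0 + sumR (seq 0 n) (fun i => sumR S0 (fun x => alpha i (cell x) + beta i (cell x)))
    <= 0).
  { rewrite (sumR_swap (seq 0 n) S0 (fun i x => alpha i (cell x) + beta i (cell x))).
    unfold m0, orbit_count; rewrite <- sumR_plus.
    rewrite <- (sumR_0 S0); apply sumR_le; intros x _.
    destruct (hc x) as (hx & _ & hx0); specialize (hvtx _ hx).
    apply indic_le in hx0; lra. }
  assert (h2 : 0 <= sumR (seq 0 n) (fun i =>
      sumR S0 (fun x => alpha i (cell x) + beta i (cell x)))
    + INR n * (2 * C * delta * INR (length S0))).
  { rewrite <- (length_seq n 0) at 2; rewrite <- sumR_const, <- sumR_plus.
    apply sumR_ge0; intros i hi; apply in_seq in hi.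
    apply (hker r); [exact hr|apply Rmin_r|lia|exact hS]. }
  assert (h3 : INR n * (2 * C * delta * INR (length S0)) <= delta * (2 * INR n * C * D) * m0).
  { replace (INR n * (2 * C * delta * INR (length S0))) with
      (2 * INR n * C * delta * INR (length S0)) by ring.
    replace (delta * (2 * INR n * C * D) * m0) with (2 * INR n * C * delta * (D * m0)) by ring.
    apply Rmult_le_compat_l; [|exact hlen].
    repeat apply Rmult_le_pos; auto using pos_INR; lra. }
  apply Rmult_lt_compat_r with (r := m0) in hdelta1; [lra|exact hm0].
Qed.

Lemma approximating_permutations (n : nat) (g : nat -> G) eps : 0 < eps ->
  exists (m : nat) (x : nat -> G) (v0 : nat), (v0 < m)%nat /\ x v0 = gone /\
    forall i, (i < n)%nat -> exists sg tau : nat -> nat,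
      (forall v, tau (sg v) = v) /\ (forall v, sg (tau v) = v) /\
      (forall v, (v < m)%nat <-> (sg v < m)%nat) /\
      (forall v, (v < m)%nat -> exists gam, Gam gam /\
         nrm (gmul (ginv (gmul (x v) (g i))) (gmul gam (x (sg v)))) <= eps).
Proof.
  intros heps.
  destruct (conj_small_uniform n (fun i => ginv (g i)) (eps / 3)) as [rho [hrho [hrho' hconj]]];
    [lra|].
  destruct bounded_fundamental_domain as [R hR].
  destruct (ball_cover R rho hrho) as [L hL].
  (* The identity is prepended to make it the centre of cell 0. *)
  set (t := fun j => nth j (gone :: L) gone).
  destruct (permutations_or_dual n (length (gone :: L)) (fun i j k => exists gam, Gam gam /\
    nrm (gmul (ginv (gmul (t j) (g i))) (gmul gam (t k))) <= eps))
    as [[m [cell [v0 [hv0 [hcell hperm]]]]]|[alpha [beta [hedge hvtx]]]].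
  - exists m, (fun v => t (cell v)), v0; rewrite hcell; auto.
  - exfalso; apply (dual_certificate_absurd n (length (gone :: L)) g t rho eps alpha beta); auto.
    + lra.
    + intros i u hi hu; specialize (hconj i u hi hu); rewrite ginvK in hconj; lra.
    + simpl; lia.
    + intros x; destruct (hR x) as [gam [hgam hx]].
      destruct (hL _ hx) as [h [hh hlt]].
      destruct (In_nth _ _ gone hh) as [j [hj e]].
      exists (S j); split; [simpl; lia|]; exists gam; split; [exact hgam|].
      change (t (S j)) with (nth j L gone); rewrite e; lra.
Qed.
End Lattice.

(** * The perturbed homomorphism *)

Section Cocycles.
Context {G : group} (Gam : G -> Prop) (hGsub : is_subgroup Gam) (m : nat).

(* A permutation of the vertices [v < m] (extended to [nat]), its inverse, and a
   [Gam]-valued label of each edge [v -> sg v]. *)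
Record labelled_perm := LabelledPerm {
  fwd : nat -> nat;
  bwd : nat -> nat;
  lab : nat -> G;
  bwd_fwd : forall v, bwd (fwd v) = v;
  fwd_bwd : forall v, fwd (bwd v) = v;
  fwd_lt : forall v, (v < m)%nat <-> (fwd v < m)%nat;
  lab_in : forall v, Gam (lab v)
}.

Lemma labelled_perm_eq (p q : labelled_perm) :
  (forall v, fwd p v = fwd q v) -> (forall v, bwd p v = bwd q v) ->
  (forall v, lab p v = lab q v) -> p = q.
Proof.
  destruct p, q; simpl; intros h1 h2 h3.
  apply functional_extensionality in h1, h2, h3; subst.
  f_equal; apply proof_irrelevance.
Qed.

(** [p] acts first and labels multiply along the path. A homomorphism from [F] into the resulting
    group is a right action on vertices together with a [Gam]-valued cocycle. *)
Definition lp_mul (p q : labelled_perm) : labelled_perm.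
Proof.
  refine (LabelledPerm (fun v => fwd q (fwd p v)) (fun v => bwd p (bwd q v))
    (fun v => gmul (lab p v) (lab q (fwd p v))) _ _ _ _).
  - intros v; rewrite !bwd_fwd; reflexivity.
  - intros v; rewrite !fwd_bwd; reflexivity.
  - intros v; rewrite <- !fwd_lt; reflexivity.
  - intros v; apply hGsub; apply lab_in.
Defined.

Definition lp_inv (p : labelled_perm) : labelled_perm.
Proof.
  refine (LabelledPerm (bwd p) (fwd p) (fun v => ginv (lab p (bwd p v))) _ _ _ _).
  - apply fwd_bwd.
  - apply bwd_fwd.
  - intros v; rewrite (fwd_lt p (bwd p v)), fwd_bwd; reflexivity.
  - intros v; apply hGsub, lab_in.
Defined.

Definition lp_one : labelled_perm.
Proof.
  refine (LabelledPerm (fun v => v) (fun v => v) (fun _ => gone) _ _ _ _); try reflexivity.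
  intros v; apply hGsub.
Defined.

Definition labelled_perm_group : group.
Proof.
  refine (Group labelled_perm lp_mul lp_inv lp_one _ _ _ _ _); intros;
    apply labelled_perm_eq; intros v; simpl;
    rewrite ?bwd_fwd, ?fwd_bwd, ?gmulA, ?gmul1l, ?gmul1r, ?gmulVl, ?gmulVr; reflexivity.
Defined.
End Cocycles.

(** For a right action the left coset of [f] modulo the stabilizer is determined by
    [act (ginv f) v0], which takes at most [m] values. *)
Lemma finite_index_stabilizer (F : group) (m v0 : nat) (act : F -> nat -> nat) :
  (v0 < m)%nat -> (forall f v, (v < m)%nat -> (act f v < m)%nat) ->
  (forall f f' v, act (gmul f f') v = act f' (act f v)) -> (forall v, act gone v = v) ->
  is_subgroup (fun f => act f v0 = v0) /\ finite_index (fun f => act f v0 = v0).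
Proof.
  intros hv0 hlt hact hact1.
  assert (hV : forall f, act (ginv f) (act f v0) = v0).
  { intros f; rewrite <- hact, gmulVr; apply hact1. }
  split; [split; [apply hact1|split]|].
  - intros f f' h h'; rewrite hact, h; exact h'.
  - intros f h; rewrite <- h at 1; apply hV.
  - assert (hch : forall v, exists r : F, forall f, act (ginv f) v0 = v -> act (ginv r) v0 = v).
    { intros v; destruct (classic (exists f, act (ginv f) v0 = v)) as [[r hr]|hno].
      - exists r; intros; exact hr.
      - exists gone; intros f hf; destruct hno; eauto. }
    set (rep := fun v => proj1_sig (constructive_indefinite_description _ (hch v))).
    assert (hrep : forall v f, act (ginv f) v0 = v -> act (ginv (rep v)) v0 = v).
    { intros v; exact (proj2_sig (constructive_indefinite_description _ (hch v))). }
    exists (map rep (seq 0 m)); intros f.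
    set (v := act (ginv f) v0).
    exists (rep v), (gmul (ginv (rep v)) f); split; [|split].
    + apply in_map, in_seq; split; [lia|]; apply hlt, hv0.
    + rewrite hact, (hrep v f eq_refl); unfold v.
      rewrite <- hact, gmulVl; apply hact1.
    + rewrite gmulKV; reflexivity.
Qed.

Theorem theorem1 (G : group) (d : G -> G -> R)
  (hd : is_metric d) (hli : left_invariant d) (hprop : proper_metric d)
  (htop : topological_group d) (hlc : locally_compact d)
  (Gam : G -> Prop) (hGsub : is_subgroup Gam) (hGdisc : discrete_in d Gam)
  (hGcoc : cocompact d Gam)
  (F : group) (n : nat) (b : nat -> F) (hb : free_basis F n b)
  (phi : F -> G) (hphi : is_hom phi) :
  forall eps : R, 0 < eps ->
    exists phie : F -> G, perturbation d n b phi phie eps /\ virtually_hom_into phie Gam.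
Proof.
  intros eps heps.
  (* The error at an inverse generator is the inverse of an error at [b i], conjugated by
     [phi (b i)]; [eps'] keeps both kinds below [eps]. *)
  destruct (conj_small_uniform d hd hli htop n (fun i => phi (b i)) eps heps)
    as [eps' [heps' [hle hconj]]].
  destruct (approximating_permutations d hd hli hprop htop Gam hGsub hGdisc hGcoc n
    (fun i => phi (b i)) eps' heps') as [m [x [v0 [hv0 [hx0 hperm]]]]].
  set (H := labelled_perm_group Gam hGsub m).
  assert (hgen : forall i, exists w : H, (i < n)%nat -> forall v, (v < m)%nat ->
    gnorm d (gmul (ginv (gmul (x v) (phi (b i)))) (gmul (lab _ _ w v) (x (fwd _ _ w v)))) <= eps').
  { intros i; destruct (classic (i < n)%nat) as [hi|hi]; [|exists gone; tauto].
    destruct (hperm i hi) as [sg [tau [h1 [h2 [h3 h4]]]]].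
    assert (hch : forall v, exists gam, Gam gam /\ ((v < m)%nat ->
      gnorm d (gmul (ginv (gmul (x v) (phi (b i)))) (gmul gam (x (sg v)))) <= eps')).
    { intros v; destruct (classic (v < m)%nat) as [hv|hv].
      - destruct (h4 v hv) as [gam [hg hn]]; eauto.
      - exists gone; split; [apply hGsub|tauto]. }
    set (c := fun v => proj1_sig (constructive_indefinite_description _ (hch v))).
    assert (hc : forall v, Gam (c v) /\ ((v < m)%nat ->
      gnorm d (gmul (ginv (gmul (x v) (phi (b i)))) (gmul (c v) (x (sg v)))) <= eps')).
    { intros v; exact (proj2_sig (constructive_indefinite_description _ (hch v))). }
    exists (LabelledPerm Gam m sg tau c h1 h2 h3 (fun v => proj1 (hc v))).
    intros _ v hv; exact (proj2 (hc v) hv). }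
  set (w := fun i => proj1_sig (constructive_indefinite_description _ (hgen i))).
  assert (hw : forall i, (i < n)%nat -> forall v, (v < m)%nat ->
    gnorm d (gmul (ginv (gmul (x v) (phi (b i))))
      (gmul (lab _ _ (w i) v) (x (fwd _ _ (w i) v)))) <= eps').
  { intros i; exact (proj2_sig (constructive_indefinite_description _ (hgen i))). }
  clearbody w.
  destruct (hb H w) as [Phi [hPhi [hPhib _]]].
  set (act := fun f v => fwd _ _ (Phi f) v).
  set (c := fun f v => lab _ _ (Phi f) v).
  assert (hact : forall f f' v, act (gmul f f') v = act f' (act f v)).
  { intros; unfold act; rewrite hPhi; reflexivity. }
  assert (hcoc : forall f f' v, c (gmul f f') v = gmul (c f v) (c f' (act f v))).
  { intros; unfold c; rewrite hPhi; reflexivity. }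
  assert (hlt : forall f v, (v < m)%nat -> (act f v < m)%nat).
  { intros f v hv; exact (proj1 (fwd_lt _ _ (Phi f) v) hv). }
  assert (hact1 : forall v, act gone v = v).
  { intros v; unfold act; rewrite (hom1 _ hPhi); reflexivity. }
  exists (fun f => gmul (c f v0) (x (act f v0))); split.
  - intros f s [i [hi hs]].
    set (v := act f v0).
    assert (hv : (v < m)%nat) by (apply hlt, hv0).
    rewrite (proj1 (proj2 (proj2 hd))), (dist_nrm d hli), hact, hcoc; fold v.
    destruct hs as [->| ->].
    + specialize (hw i hi v hv); rewrite <- hPhib in hw by exact hi.
      fold (act (b i) v) (c (b i) v) in hw; revert hw; grp; lra.
    + rewrite (homV _ hphi).
      (* The inverse generator traverses backwards the edge of [b i] from [v'] to [v], so its label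
         is the inverse one. *)
      set (v' := act (ginv (b i)) v).
      assert (hv' : (v' < m)%nat) by (apply hlt, hv).
      assert (ev : act (b i) v' = v).
      { unfold v'; rewrite <- hact, gmulVl; apply hact1. }
      specialize (hw i hi v' hv'); rewrite <- hPhib in hw by exact hi.
      fold (act (b i) v') (c (b i) v') in hw; rewrite ev in hw.
      rewrite <- (nrmV d hd hli) in hw; apply (hconj i _ hi) in hw.
      assert (ec : c (ginv (b i)) v = ginv (c (b i) v')).
      { symmetry; apply ginv_unique.
        pose proof (hcoc (b i) (ginv (b i)) v') as h; rewrite ev, gmulVr in h.
        rewrite <- h; unfold c; rewrite (hom1 _ hPhi); reflexivity. }
      rewrite ec; revert hw; grp; tauto.
  - destruct (finite_index_stabilizer F m v0 act hv0 hlt hact hact1) as [h1 h2].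
    exists (fun f => act f v0 = v0); split; [exact h1|split; [exact h2|split]].
    (* The path of [f1] closes up at [v0], whose lift is the identity; the cocycle relation then
       becomes multiplicativity. *)
    + intros f1 f2 hf1; rewrite hact, hcoc, hf1, hx0, gmul1r, gmulA; reflexivity.
    + intros f1 hf1; rewrite hf1, hx0, gmul1r; apply lab_in.
Qed.
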